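(* Let $k$ be a field. Every (cohomological) spectral sequence $(E_r,d_r,i_r)_{r\in\mathbb{N}}$ of $k$-modules can be obtained from a filtration on a complex: there exist a complex $(M,d_M)$ of $k$-modules and a decreasing filtration $\{F^pM\}_{p\in\mathbb{Z}}$ of $M$ by graded submodules with $d_M(F^pM)\subseteq F^pM$ for all $p\in\mathbb{Z}$, such that the spectral sequence starting at $1$ associated to this filtration is isomorphic to $(E_r,d_r,i_r)_{r\in\mathbb{N}}$.
   Context: $\mathbb{N}$ is the set of positive integers. A (cohomological) spectral sequence of $k$-modules consists of $k$-modules $E_r^{p,q}$ and $k$-linear maps $d_r^{p,q}:E_r^{p,q}\to E_r^{p+r,q-r+1}$ with $d_r\circ d_r=0$, for $p,q\in\mathbb{Z}$, $r\in\mathbb{N}$, together with isomorphisms $i_r^{p,q}:\ker(d_r^{p,q})/\mathrm{Im}(d_r^{p-r,q+r-1})\to E_{r+1}^{p,q}$; no boundedness is assumed. A morphism is a family of maps $f_r:E_r\to E'_r$ of bidegree $(0,0)$ commuting with the differentials $d_r$ and with the maps $i_r$ (that is, $f_{r+1}\circ i_r=i'_r\circ H(f_r)$). The spectral sequence starting at $1$ associated to the filtration is the usual one of a filtered complex, with $E_1^{p,q}=H^{p+q}(F^pM/F^{p+1}M)$; it is the spectral sequence of the exact couple given by the long exact cohomology sequence of $0\to\bigoplus_pF^pM\otimes k\hbar^{-p}\xrightarrow{\hbar}\bigoplus_pF^pM\otimes k\hbar^{-p}\to\bigoplus_pF^pM/F^{p+1}M\to0$, with $F^pM^{p+q}\otimes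 k\hbar^{-p}$ and $F^pM^{p+q}/F^{p+1}M^{p+q}$ in bidegree $(p,q)$ and differentials induced by $d_M$. *)

(* Defs.v *)
From HB Require Import structures.
From mathcomp Require Import all_boot all_order all_algebra generic_quotient.
From mathcomp Require Import ring_quotient boolp zify.
Set Implicit Arguments.
Unset Strict Implicit.
Unset Printing Implicit Defensive.
Import Order.TTheory GRing.Theory.
Local Open Scope ring_scope.
Local Open Scope quotient_scope.

Section Submodule.
Variables (k : fieldType) (V : lmodType k).

Record submod (S : submodClosed V) :=
  Submod { subval : V; subvalP : subval \in S }.

HB.instance Definition _ (S : submodClosed V) := [isSub for @subval S].
HB.instance Definition _ (S : submodClosed V) := [Choice of submod S by <:].
HB.instance Definition _ (S : submodClosed V) :=
  [SubChoice_isSubLmodule of submod S by <:].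

Lemma subval_linear (S : submodClosed V) : linear (@subval S).
Proof. by move=> a x y; rewrite -[subval _]/(val _) linearP. Qed.
HB.instance Definition _ (S : submodClosed V) := GRing.isLinear.Build k _ _ _
  (@subval S) (@subval_linear S).

Lemma submod_inj (S : submodClosed V) : injective (@subval S).
Proof. exact: val_inj. Qed.

Lemma submod_mem (P : V -> Prop) :
  P 0 -> (forall a x y, P x -> P y -> P (a *: x + y)) ->
  submod_closed (fun x => `[< P x >]).
Proof.
move=> P0 PL; split; first exact/asboolP.
move=> a x y /asboolP Px /asboolP Py.
by apply/asboolP; exact: PL.
Qed.

Definition mk_submod (P : V -> Prop) (P0 : P 0)
    (PL : forall a x y, P x -> P y -> P (a *: x + y)) : submodClosed V :=
  HB.pack (fun x => `[< P x >])
    (GRing.isSubmodClosed.Build k V _ (submod_mem P0 PL)).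

Lemma mk_submodE P P0 PL x : x \in @mk_submod P P0 PL <-> P x.
Proof. by split=> [/asboolP|?] //; apply/asboolP. Qed.

End Submodule.

Section SubmoduleOps.
Variables (k : fieldType) (V W : lmodType k) (f : {linear V -> W}).

Lemma ker0 : f 0 = 0. Proof. exact: linear0. Qed.
Lemma kerL a x y : f x = 0 -> f y = 0 -> f (a *: x + y) = 0.
Proof. by move=> fx fy; rewrite linearP fx fy scaler0 addr0. Qed.
Definition kermod : submodClosed V := mk_submod ker0 kerL.

Lemma im0 : exists x, f x = 0. Proof. by exists 0; exact: linear0. Qed.
Lemma imL a y z :
  (exists x, f x = y) -> (exists x, f x = z) -> exists x, f x = a *: y + z.
Proof. by move=> [x <-] [x' <-]; exists (a *: x + x'); rewrite linearP. Qed.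
Definition immod : submodClosed W := mk_submod im0 imL.

Lemma preim0 (T : submodClosed W) : f 0 \in T.
Proof. by rewrite linear0 rpred0. Qed.
Lemma preimL (T : submodClosed W) a x y :
  f x \in T -> f y \in T -> f (a *: x + y) \in T.
Proof. by move=> fx fy; rewrite linearP rpredD // rpredZ. Qed.
Definition premod (T : submodClosed W) : submodClosed V :=
  mk_submod (preim0 T) (@preimL T).

End SubmoduleOps.

Section QuotientModule.
Variables (k : fieldType) (V : lmodType k) (S : submodClosed V).

Definition quot_ideal : {pred V} := fun x => x \in S.
Lemma quot_ideal_closed : zmod_closed quot_ideal.
Proof.
split; first exact: rpred0.
move=> x y Sx Sy; rewrite /quot_ideal -[x - y]addrC -scaleN1r.
by rewrite [_ \in _]rpredD // rpredZ.
Qed.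
HB.instance Definition _ := GRing.isZmodClosed.Build V quot_ideal
  quot_ideal_closed.

Definition quotmod : Type := Quotient.quot quot_ideal.
HB.instance Definition _ := Choice.on quotmod.
HB.instance Definition _ := GRing.Zmodule.on quotmod.

Definition quot_pi (x : V) : quotmod := \pi_(Quotient.quot quot_ideal) x.

Lemma quot_piE x y : quot_pi x = quot_pi y <-> x - y \in S.
Proof.
split=> [/eqP|xy]; first by rewrite -Quotient.idealrBE.
by apply/eqP; rewrite -Quotient.idealrBE.
Qed.

Lemma quot_pi_surj u : exists x, quot_pi x = u.
Proof. by exists (repr u); exact: reprK. Qed.

Lemma quot_pi_zmod : zmod_morphism quot_pi.
Proof. by move=> x y; rewrite /quot_pi raddfB. Qed.

Definition quot_scale (a : k) (u : quotmod) : quotmod :=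
  quot_pi (a *: (repr u : V)).

Lemma quot_scaleE a x : quot_scale a (quot_pi x) = quot_pi (a *: x).
Proof.
apply/quot_piE; rewrite -scalerBr rpredZ //.
by apply/quot_piE; exact: reprK.
Qed.

Lemma quot_scaleA a b u :
  quot_scale a (quot_scale b u) = quot_scale (a * b) u.
Proof. by have [x <-] := quot_pi_surj u; rewrite !quot_scaleE scalerA. Qed.
Lemma quot_scale1 : left_id 1 quot_scale.
Proof. by move=> u; have [x <-] := quot_pi_surj u; rewrite quot_scaleE scale1r. Qed.
Lemma quot_piD x y : quot_pi (x + y) = quot_pi x + quot_pi y.
Proof. by rewrite /quot_pi raddfD. Qed.
Lemma quot_scaleDr : right_distributive quot_scale +%R.
Proof.
move=> a u v; have [x <-] := quot_pi_surj u; have [y <-] := quot_pi_surj v.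
by rewrite -quot_piD !quot_scaleE scalerDr quot_piD.
Qed.
Lemma quot_scaleDl u a b : quot_scale (a + b) u = quot_scale a u + quot_scale b u.
Proof.
by have [x <-] := quot_pi_surj u; rewrite !quot_scaleE scalerDl quot_piD.
Qed.
HB.instance Definition _ := GRing.Zmodule_isLmodule.Build k quotmod
  quot_scaleA quot_scale1 quot_scaleDr quot_scaleDl.

Lemma quot_pi_linear : linear quot_pi.
Proof. by move=> a x y; rewrite quot_piD -quot_scaleE. Qed.
HB.instance Definition _ := GRing.isLinear.Build k V quotmod _ quot_pi
  quot_pi_linear.

End QuotientModule.

Section LinearGraph.
Variables (k : fieldType) (U V : lmodType k) (R : U -> V -> Prop).
Hypothesis Rtot : forall u, exists v, R u v.
Hypothesis Rfun : forall u v v', R u v -> R u v' -> v = v'.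
Hypothesis Rlin : forall a u u' v v',
  R u v -> R u' v' -> R (a *: u + u') (a *: v + v').

Definition graph_fun (u : U) : V := projT1 (cid (Rtot u)).

Lemma graph_funP u : R u (graph_fun u).
Proof. by rewrite /graph_fun; case: cid. Qed.
Lemma graph_funE u v : R u v -> graph_fun u = v.
Proof. by move=> Ruv; apply: Rfun Ruv; exact: graph_funP. Qed.
Lemma graph_fun_linear : linear graph_fun.
Proof. by move=> a u v; apply: graph_funE; apply: Rlin; exact: graph_funP. Qed.
HB.instance Definition _ := GRing.isLinear.Build k U V _ graph_fun
  graph_fun_linear.
(* The linear map with graph R. *)
Definition graph_map : {linear U -> V} := graph_fun.

Lemma graph_mapP u : R u (graph_map u). Proof. exact: graph_funP. Qed.
Lemma graph_mapE u v : R u v -> graph_map u = v. Proof. exact: graph_funE. Qed.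

End LinearGraph.

Section InducedMaps.
Variables (k : fieldType) (V W : lmodType k) (f : {linear V -> W}).
Variables (S : submodClosed V) (T : submodClosed W).
Hypothesis fST : forall x, x \in S -> f x \in T.

Definition restrict_fun (x : submod S) : submod T := Submod (fST (subvalP x)).
Lemma restrict_linear : linear restrict_fun.
Proof. by move=> a x y; apply: val_inj; rewrite /= linearP. Qed.
HB.instance Definition _ := GRing.isLinear.Build k _ _ _ restrict_fun
  restrict_linear.
Definition restrict : {linear submod S -> submod T} := restrict_fun.

Definition quot_map_fun (u : quotmod S) : quotmod T :=
  quot_pi T (f (repr (u : Quotient.quot (quot_ideal S)))).
Lemma quot_map_funE x : quot_map_fun (quot_pi S x) = quot_pi T (f x).
Proof.
apply/quot_piE; rewrite -linearB; apply: fST.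
by apply/quot_piE; exact: reprK.
Qed.
Lemma quot_map_linear : linear quot_map_fun.
Proof.
move=> a u v.
have [x <-] := quot_pi_surj u; have [y <-] := quot_pi_surj v.
by rewrite -linearP !quot_map_funE !linearP.
Qed.
HB.instance Definition _ := GRing.isLinear.Build k _ _ _ quot_map_fun
  quot_map_linear.
Definition quot_map : {linear quotmod S -> quotmod T} := quot_map_fun.
Lemma quot_mapE x : quot_map (quot_pi S x) = quot_pi T (f x).
Proof. exact: quot_map_funE. Qed.

End InducedMaps.

Section Homology.
Variables (k : fieldType) (U V W : lmodType k).
Variables (f : {linear U -> V}) (g : {linear V -> W}).

Definition boundary : submodClosed (submod (kermod g)) :=
  premod (@subval k V (kermod g)) (immod f).

(* ker g / im f; when g \o f = 0 is not assumed, im f is replaced by its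
   intersection with ker g. *)
Definition homology : lmodType k := quotmod boundary.

Definition represents (x : V) (u : homology) : Prop :=
  exists z : submod (kermod g), subval z = x /\ quot_pi boundary z = u.

Lemma repr_cycle x u : represents x u -> g x = 0.
Proof. by case=> z [<- _]; have /mk_submodE := subvalP z. Qed.

Lemma repr_ex x : g x = 0 -> exists u, represents x u.
Proof.
move=> /(mk_submodE (ker0 g) (@kerL _ _ _ g)) gx.
by exists (quot_pi boundary (Submod gx)); exists (Submod gx).
Qed.

Lemma repr_surj u : exists x, represents x u.
Proof. by have [z <-] := quot_pi_surj u; exists (subval z); exists z. Qed.

Lemma repr_eq x y u v :
  represents x u -> represents y v -> u = v <-> exists t, f t = x - y.
Proof.
move=> [z [<- <-]] [z' [<- <-]]; split.
  by move/quot_piE/mk_submodE/mk_submodE.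
by move=> h; apply/quot_piE/mk_submodE/mk_submodE.
Qed.

Lemma repr_fun x u v : represents x u -> represents x v -> u = v.
Proof.
by move=> xu xv; apply/(repr_eq xu xv); exists 0; rewrite linear0 subrr.
Qed.

Lemma repr_lin a x y u v :
  represents x u -> represents y v -> represents (a *: x + y) (a *: u + v).
Proof.
by move=> [z [<- <-]] [z' [<- <-]]; exists (a *: z + z'); rewrite !linearP.
Qed.

Lemma repr00 : represents 0 0.
Proof. by exists 0; rewrite !linear0. Qed.

Lemma repr0 x u : represents x u -> u = 0 <-> exists t, f t = x.
Proof. by move=> xu; rewrite (repr_eq xu repr00) subr0. Qed.

End Homology.

Section HomologyMap.
Variables (k : fieldType) (U V W U' V' W' : lmodType k).
Variables (f : {linear U -> V}) (g : {linear V -> W}).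
Variables (f' : {linear U' -> V'}) (g' : {linear V' -> W'}).
Variables (hU : {linear U -> U'}) (hV : {linear V -> V'}) (hW : {linear W -> W'}).
Hypothesis hf : forall x, hV (f x) = f' (hU x).
Hypothesis hg : forall x, hW (g x) = g' (hV x).

Definition homology_rel (u : homology f g) (v : homology f' g') : Prop :=
  exists x, represents x u /\ represents (hV x) v.

Lemma homology_rel_tot u : exists v, homology_rel u v.
Proof.
have [x xu] := repr_surj u.
have [|v xv] := @repr_ex _ _ _ _ f' g' (hV x); last by exists v, x.
by rewrite -hg (repr_cycle xu) linear0.
Qed.

Lemma homology_rel_fun u v v' : homology_rel u v -> homology_rel u v' -> v = v'.
Proof.
move=> [x [xu xv]] [y [yu yv]]; apply/(repr_eq xv yv).
have [t e] := (repr_eq xu yu).1 erefl.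
by exists (hU t); rewrite -hf e linearB.
Qed.

Lemma homology_rel_lin a u u' v v' : homology_rel u v -> homology_rel u' v' ->
  homology_rel (a *: u + u') (a *: v + v').
Proof.
move=> [x [xu xv]] [y [yu yv]]; exists (a *: x + y).
by rewrite linearP; split; exact: repr_lin.
Qed.

Definition homology_map : {linear homology f g -> homology f' g'} :=
  graph_map homology_rel_tot homology_rel_fun homology_rel_lin.

Lemma homology_mapE x u : represents x u -> represents (hV x) (homology_map u).
Proof.
move=> xu; have [|v xv] := @repr_ex _ _ _ _ f' g' (hV x).
  by rewrite -hg (repr_cycle xu) linear0.
suff -> : homology_map u = v by [].
by apply: graph_mapE; exists x.
Qed.

End HomologyMap.

Lemma index_prev (a p : int) : p = p - a + a.
Proof. by rewrite subrK. Qed.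

Section Complexes.
Variable k : fieldType.

(* The differential is indexed by a proof of n' = n + 1, not by n alone, so that
   the map into degree n can be written without transporting along an equality;
   such proofs being unique, this is no additional data. *)
Record complex := Complex {
  cobj :> int -> lmodType k;
  cdif : forall n n', n' = n + 1 -> {linear cobj n -> cobj n'};
  cdifK : forall n n' n'' (e : n' = n + 1) (e' : n'' = n' + 1) x,
    cdif e' (cdif e x) = 0 }.

Definition cohomology (C : complex) (n : int) : lmodType k :=
  homology (cdif C (index_prev 1 n)) (cdif C (erefl (n + 1))).

Definition cohom_repr (C : complex) n (x : C n) (u : cohomology C n) : Prop :=
  represents x u.

Record chain_map (A B : complex) := ChainMap {
  cmap :> forall n, {linear A n -> B n};
  cmapE : forall n n' (e : n' = n + 1) x, cmap n' (cdif A e x) = cdif B e (cmap n x) }.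

Definition cohomology_map (A B : complex) (h : chain_map A B) n n' (e : n = n') :
    {linear cohomology A n -> cohomology B n'} :=
  match e with
  | erefl => homology_map (cmapE h (index_prev 1 n)) (cmapE h (erefl (n + 1)))
  end.

Record short_exact (A B C : complex) (i : chain_map A B) (s : chain_map B C) := {
  ses_inj : forall n, injective (i n);
  ses_mid : forall n y, s n y = 0 <-> exists x, i n x = y;
  ses_surj : forall n z, exists y, s n y = z }.

Lemma cohom_cycle (C : complex) n n' (e : n' = n + 1) x (u : cohomology C n) :
  cohom_repr x u -> cdif C e x = 0.
Proof. by move=> xu; subst n'; exact: repr_cycle xu. Qed.

Lemma cohom_ex (C : complex) n n' (e : n' = n + 1) x :
  cdif C e x = 0 -> exists u : cohomology C n, cohom_repr x u.
Proof. by subst n'; exact: repr_ex. Qed.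

Lemma cohom_eq (C : complex) n0 n (e : n = n0 + 1) x y (u v : cohomology C n) :
  cohom_repr x u -> cohom_repr y v -> u = v <-> exists t, cdif C e t = x - y.
Proof.
have e0 : n0 = n - 1 by rewrite e addrK.
subst n0; rewrite (eq_irrelevance e (index_prev 1 n)).
exact: repr_eq.
Qed.

Lemma cohom0 (C : complex) n0 n (e : n = n0 + 1) x (u : cohomology C n) :
  cohom_repr x u -> u = 0 <-> exists t, cdif C e t = x.
Proof. by move=> xu; rewrite (cohom_eq e xu (repr00 _ _)) subr0. Qed.

Lemma cohomology_mapE (A B : complex) (h : chain_map A B) n x
    (u : cohomology A n) (e : n = n) :
  cohom_repr x u -> cohom_repr (h n x) (cohomology_map h e u).
Proof. by rewrite (eq_irrelevance e erefl); exact: homology_mapE. Qed.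

Section Connecting.
Variables (A B C : complex) (i : chain_map A B) (s : chain_map B C).
Hypothesis SE : short_exact i s.
Variables (n n' : int) (e : n' = n + 1).

(* The snake: lift a cocycle of C to b in B, and pull its differential back
   to A. *)
Definition connecting_rel (u : cohomology C n) (v : cohomology A n') : Prop :=
  exists (b : B n) (a : A n'),
    [/\ cohom_repr (s n b) u, cohom_repr a v & i n' a = cdif B e b].

Lemma connecting_ex (b : B n) (u : cohomology C n) :
  cohom_repr (s n b) u -> exists a v, cohom_repr a v /\ i n' a = cdif B e b.
Proof.
move=> bu; have /(ses_mid SE)[a ea] : s n' (cdif B e b) = 0.
  by rewrite cmapE (cohom_cycle e bu).
exists a; suff [v av] : exists v : cohomology A n', cohom_repr a v by exists v.
apply: (cohom_ex (e := erefl)); apply: (ses_inj SE).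
by rewrite cmapE ea cdifK linear0.
Qed.

Lemma connecting_rel_tot u : exists v, connecting_rel u v.
Proof.
have [z zu] := repr_surj u; have [b eb] := ses_surj SE z; subst z.
by have [a [v [av ea]]] := connecting_ex zu; exists v, b, a.
Qed.

Lemma connecting_rel_fun u v v' :
  connecting_rel u v -> connecting_rel u v' -> v = v'.
Proof.
move=> [b [a [bu av ea]]] [b' [a' [bu' av' ea']]].
apply/(cohom_eq e av av').
have [t et] := (cohom_eq (index_prev 1 n) bu bu').1 erefl.
have [t' et'] := ses_surj SE t; subst t.
have /(ses_mid SE)[w ew] : s n (b - b' - cdif B (index_prev 1 n) t') = 0.
  by rewrite !linearB cmapE et subrr.
exists w; apply: (ses_inj SE); rewrite cmapE ew !linearB ea ea'.
by rewrite cdifK subr0.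
Qed.

Lemma connecting_rel_lin a u u' v v' : connecting_rel u v ->
  connecting_rel u' v' -> connecting_rel (a *: u + u') (a *: v + v').
Proof.
move=> [b [c [bu cv ec]]] [b' [c' [bu' cv' ec']]].
exists (a *: b + b'), (a *: c + c'); rewrite !linearP ec ec'.
by split=> //; exact: repr_lin.
Qed.

Definition connecting : {linear cohomology C n -> cohomology A n'} :=
  graph_map connecting_rel_tot connecting_rel_fun connecting_rel_lin.

Lemma connectingE b a (u : cohomology C n) (v : cohomology A n') :
  cohom_repr (s n b) u -> cohom_repr a v -> i n' a = cdif B e b ->
  connecting u = v.
Proof. by move=> bu av ea; apply: graph_mapE; exists b, a. Qed.

End Connecting.

Section LongExact.
Variables (A B C : complex) (i : chain_map A B) (s : chain_map B C).
Hypothesis SE : short_exact i s.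

Lemma les_mid n (u : cohomology B n) :
  cohomology_map s erefl u = 0 <-> exists v, cohomology_map i (erefl n) v = u.
Proof.
split.
  have [b bu] := repr_surj u.
  move=> /(cohom0 (index_prev 1 n) (cohomology_mapE s erefl bu))[t].
  have [t' <-] := ses_surj SE t; rewrite -cmapE => et.
  have /(ses_mid SE)[a ea] : s n (b - cdif B (index_prev 1 n) t') = 0.
    by rewrite linearB et subrr.
  have [v av] : exists v : cohomology A n, cohom_repr a v.
    apply: (cohom_ex (e := erefl)); apply: (ses_inj SE).
    by rewrite cmapE ea linearB cdifK (cohom_cycle erefl bu) subr0 linear0.
  exists v; apply/(cohom_eq (index_prev 1 n) (cohomology_mapE i erefl av) bu).
  by exists (- t'); rewrite linearN ea addrAC subrr add0r.
move=> [v <-]; have [a av] := repr_surj v.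
apply/(cohom0 (index_prev 1 n)
  (cohomology_mapE s erefl (cohomology_mapE i erefl av))).
by exists 0; rewrite linear0; apply/esym/(ses_mid SE); exists a.
Qed.

Lemma les_right n n' (e : n' = n + 1) (u : cohomology C n) :
  connecting SE e u = 0 <-> exists v, cohomology_map s (erefl n) v = u.
Proof.
split.
  have [z zu] := repr_surj u; have [b eb] := ses_surj SE z; subst z.
  have [a [v [av ea]]] := connecting_ex SE e zu.
  rewrite (connectingE SE zu av ea) => /(cohom0 e av)[t et].
  have [w bw] : exists w : cohomology B n, cohom_repr (b - i n t) w.
    by apply: (cohom_ex (e := e)); rewrite linearB -cmapE et ea subrr.
  exists w; apply/(cohom_eq (index_prev 1 n) (cohomology_mapE s erefl bw) zu).
  exists 0; rewrite linear0 linearB addrAC subrr add0r.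
  by apply/esym/eqP; rewrite oppr_eq0; apply/eqP/(ses_mid SE); exists t.
move=> [v <-]; have [b bv] := repr_surj v.
apply: (connectingE SE (b := b) (a := 0)) (repr00 _ _) _.
  exact: cohomology_mapE.
by rewrite linear0 (cohom_cycle e bv).
Qed.

Lemma les_left n n' (e : n' = n + 1) (u : cohomology A n') :
  cohomology_map i (erefl n') u = 0 <-> exists v, connecting SE e v = u.
Proof.
split.
  have [a au] := repr_surj u.
  move=> /(cohom0 e (cohomology_mapE i erefl au))[b eb].
  have [v bv] : exists v : cohomology C n, cohom_repr (s n b) v.
    apply: (cohom_ex (e := e)); rewrite -cmapE eb.
    by apply/(ses_mid SE); exists a.
  by exists v; apply: (connectingE SE bv au).
move=> [v <-].
have [z zv] := repr_surj v; have [b eb] := ses_surj SE z; subst z.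
have [a [u' [au ea]]] := connecting_ex SE e zv.
rewrite (connectingE SE zv au ea).
by apply/(cohom0 e (cohomology_mapE i erefl au)); exists b.
Qed.

End LongExact.
End Complexes.

Section Bigraded.
Variable k : fieldType.

Definition bimod := int -> int -> lmodType k.

(* Maps of bidegree (a, b), with the target indices given up to a proof of
   equality, as for the differential of a complex. *)
Definition bihom (a b : int) (A B : bimod) :=
  forall p q p' q', p' = p + a -> q' = q + b -> {linear A p q -> B p' q'}.

Definition biimage a b (A B : bimod) (f : bihom a b A B) p q :
    submodClosed (B p q) :=
  immod (f _ _ p q (index_prev a p) (index_prev b q)).

(* ker (d^{p,q}) / im (d^{p-a,q-b}) *)
Definition bihomology a b (E : bimod) (d : bihom a b E E) : bimod :=
  fun p q => homology (d _ _ p q (index_prev a p) (index_prev b q))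
                      (d p q _ _ (erefl (p + a)) (erefl (q + b))).

Definition biexact a b c d (A B C : bimod) (f : bihom a b A B) (g : bihom c d B C) :=
  forall (p0 q0 p q p1 q1 : int) (hp : p = p0 + a) (hq : q = q0 + b)
    (hp1 : p1 = p + c) (hq1 : q1 = q + d) (y : B p q),
  g _ _ _ _ hp1 hq1 y = 0 <-> exists x, f _ _ _ _ hp hq x = y.

Definition bihomology_map a b (E E' : bimod) (d : bihom a b E E)
    (d' : bihom a b E' E') (f : forall p q, {linear E p q -> E' p q})
    (hf : forall p q p' q' (hp : p' = p + a) (hq : q' = q + b) x,
      f p' q' (d _ _ _ _ hp hq x) = d' _ _ _ _ hp hq (f p q x)) p q :
    {linear bihomology d p q -> bihomology d' p q} :=
  homology_map (hf _ _ p q (index_prev a p) (index_prev b q))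
               (hf p q _ _ (erefl (p + a)) (erefl (q + b))).

Lemma biimageP a b (A B : bimod) (f : bihom a b A B) p0 q0 p q
    (hp : p = p0 + a) (hq : q = q0 + b) y :
  y \in biimage f p q <-> exists x, f _ _ _ _ hp hq x = y.
Proof.
have e0 : p0 = p - a by rewrite hp addrK.
have e1 : q0 = q - b by rewrite hq addrK.
subst p0 q0; rewrite (eq_irrelevance hp (index_prev a p)).
by rewrite (eq_irrelevance hq (index_prev b q)); exact: mk_submodE.
Qed.

Section BihomologyFacts.
Variables (a b : int) (E : bimod) (d : bihom a b E E).

Definition birepr p q (x : E p q) (u : bihomology d p q) : Prop :=
  represents x u.

Lemma birepr_cycle p q p' q' (hp : p' = p + a) (hq : q' = q + b) x
    (u : bihomology d p q) : birepr x u -> d hp hq x = 0.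
Proof. by move=> xu; subst p' q'; exact: repr_cycle xu. Qed.

Lemma birepr_ex p q p' q' (hp : p' = p + a) (hq : q' = q + b) x :
  d hp hq x = 0 -> exists u : bihomology d p q, birepr x u.
Proof. by subst p' q'; exact: repr_ex. Qed.

Lemma birepr_eq p0 q0 p q (hp : p = p0 + a) (hq : q = q0 + b) x y
    (u v : bihomology d p q) :
  birepr x u -> birepr y v -> u = v <-> exists t, d hp hq t = x - y.
Proof.
have e0 : p0 = p - a by rewrite hp addrK.
have e1 : q0 = q - b by rewrite hq addrK.
subst p0 q0; rewrite (eq_irrelevance hp (index_prev a p)).
rewrite (eq_irrelevance hq (index_prev b q)); exact: repr_eq.
Qed.

Lemma birepr0 p0 q0 p q (hp : p = p0 + a) (hq : q = q0 + b) x
    (u : bihomology d p q) :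
  birepr x u -> u = 0 <-> exists t, d hp hq t = x.
Proof. by move=> xu; rewrite (birepr_eq hp hq xu (repr00 _ _)) subr0. Qed.

End BihomologyFacts.

(* The pages are numbered from 0: ss_page r is E_{r+1}, and ss_dif r is d_{r+1},
   of bidegree (r + 1, 1 - (r + 1)). *)
Record spectral_sequence := SpectralSequence {
  ss_page : nat -> bimod;
  ss_dif : forall r, bihom r.+1%:Z (1 - r.+1%:Z) (ss_page r) (ss_page r);
  ss_difK : forall r (p q p' q' p'' q'' : int)
    (hp : p' = p + r.+1%:Z) (hq : q' = q + (1 - r.+1%:Z))
    (hp' : p'' = p' + r.+1%:Z) (hq' : q'' = q' + (1 - r.+1%:Z)) x,
    ss_dif hp' hq' (ss_dif hp hq x) = 0;
  ss_iso : forall r p q,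
    {linear bihomology (@ss_dif r) p q -> ss_page r.+1 p q};
  ss_iso_bij : forall r p q, bijective (ss_iso r p q) }.

Record ss_morphism (E E' : spectral_sequence) := SSMorphism {
  ssm :> forall r p q, {linear ss_page E r p q -> ss_page E' r p q};
  ssm_dif : forall r (p q p' q' : int) (hp : p' = p + r.+1%:Z) (hq : q' = q + (1 - r.+1%:Z)) x,
    ssm r p' q' (ss_dif E hp hq x) = ss_dif E' hp hq (ssm r p q x);
  ssm_iso : forall r p q (u : bihomology (@ss_dif E r) p q),
    ssm r.+1 p q (ss_iso E r p q u) =
    ss_iso E' r p q (bihomology_map (@ssm_dif r) p q u) }.

Definition ss_isomorphic (E E' : spectral_sequence) : Prop :=
  exists f : ss_morphism E E', forall r p q, bijective (f r p q).

(* The bidegrees are those of the couple obtained after s derivations, so that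
   its differential be \o ga has bidegree (s + 1, - s), as on the page E_{s+1}. *)
Record exact_couple (s : nat) := ExactCouple {
  ec_D : bimod;
  ec_E : bimod;
  ec_al : bihom (-1) 1 ec_D ec_D;
  ec_be : bihom s%:Z (- s%:Z) ec_D ec_E;
  ec_ga : bihom 1 0 ec_E ec_D;
  ec_al_be : biexact ec_al ec_be;
  ec_be_ga : biexact ec_be ec_ga;
  ec_ga_al : biexact ec_ga ec_al }.

Lemma ec_dif_p (s : nat) (p p' : int) : p' = p + s.+1%:Z -> p' = p + 1 + s%:Z.
Proof. by lia. Qed.
Lemma ec_dif_q (s : nat) (q q' : int) :
  q' = q + (1 - s.+1%:Z) -> q' = q + 0 + - s%:Z.
Proof. by lia. Qed.

Definition ec_dif s (C : exact_couple s) :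
    bihom s.+1%:Z (1 - s.+1%:Z) (ec_E C) (ec_E C) :=
  fun p q p' q' hp hq =>
    ec_be C (ec_dif_p hp) (ec_dif_q hq) \o ec_ga C (erefl (p + 1)) (erefl (q + 0)).

Section CoupleFacts.
Variables (s : nat) (C : exact_couple s).

Lemma ec_difE (p q p1 q1 p' q' : int) (hp : p' = p + s.+1%:Z) (hq : q' = q + (1 - s.+1%:Z))
    (hp1 : p1 = p + 1) (hq1 : q1 = q + 0) (hp2 : p' = p1 + s%:Z) (hq2 : q' = q1 + - s%:Z) x :
  ec_dif C hp hq x = ec_be C hp2 hq2 (ec_ga C hp1 hq1 x).
Proof.
subst p1 q1; rewrite /ec_dif /=.
by rewrite (eq_irrelevance (ec_dif_p hp) hp2) (eq_irrelevance (ec_dif_q hq) hq2).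
Qed.

Lemma ec_be_al0 (p0 q0 p q p1 q1 : int) (hp : p = p0 + -1) (hq : q = q0 + 1)
    (hp1 : p1 = p + s%:Z) (hq1 : q1 = q + - s%:Z) x :
  ec_be C hp1 hq1 (ec_al C hp hq x) = 0.
Proof. by apply/(ec_al_be hp hq); exists x. Qed.
Lemma ec_ga_be0 (p0 q0 p q p1 q1 : int) (hp : p = p0 + s%:Z) (hq : q = q0 + - s%:Z)
    (hp1 : p1 = p + 1) (hq1 : q1 = q + 0) x :
  ec_ga C hp1 hq1 (ec_be C hp hq x) = 0.
Proof. by apply/(ec_be_ga hp hq); exists x. Qed.
Lemma ec_al_ga0 (p0 q0 p q p1 q1 : int) (hp : p = p0 + 1) (hq : q = q0 + 0)
    (hp1 : p1 = p + -1) (hq1 : q1 = q + 1) x :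
  ec_al C hp1 hq1 (ec_ga C hp hq x) = 0.
Proof. by apply/(ec_ga_al hp hq); exists x. Qed.

Lemma ec_difK (p q p' q' p'' q'' : int) (hp : p' = p + s.+1%:Z) (hq : q' = q + (1 - s.+1%:Z))
    (hp' : p'' = p' + s.+1%:Z) (hq' : q'' = q' + (1 - s.+1%:Z)) x :
  ec_dif C hp' hq' (ec_dif C hp hq x) = 0.
Proof. by rewrite /ec_dif /= ec_ga_be0 linear0. Qed.

End CoupleFacts.

Section Derived.
Variables (s : nat) (C : exact_couple s).
Local Notation al := (ec_al C).
Local Notation be := (ec_be C).
Local Notation ga := (ec_ga C).
Local Notation rep := (birepr (d := ec_dif C)).

Definition der_D : bimod := fun p q => submod (biimage al p q).
Definition der_E : bimod := bihomology (ec_dif C).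

Lemma der_al_mem p q p' q' (hp : p' = p + -1) (hq : q' = q + 1) x :
  x \in biimage al p q -> al hp hq x \in biimage al p' q'.
Proof. by move=> _; apply/(biimageP al hp hq); exists x. Qed.

Definition der_al : bihom (-1) 1 der_D der_D :=
  fun p q p' q' hp hq => restrict (der_al_mem hp hq).

Lemma der_be_p (p p' : int) : p' = p + s.+1%:Z -> p' = p - -1 + s%:Z.
Proof. by lia. Qed.
Lemma der_be_q (q q' : int) : q' = q + - s.+1%:Z -> q' = q - 1 + - s%:Z.
Proof. by lia. Qed.

Section DerBe.
Variables (p q p' q' : int) (hp : p' = p + s.+1%:Z) (hq : q' = q + - s.+1%:Z).

(* al x |-> [be x] *)
Definition der_be_rel (y : der_D p q) (u : der_E p' q') : Prop :=
  exists x, al (index_prev (-1) p) (index_prev 1 q) x = subval y /\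
            rep (be (der_be_p hp) (der_be_q hq) x) u.

Lemma der_be_rel_tot y : exists u, der_be_rel y u.
Proof.
have /(biimageP al (index_prev (-1) p) (index_prev 1 q))[x ex] := subvalP y.
have [|u xu] := @birepr_ex _ _ _ (ec_dif C) p' q' _ _ erefl erefl
  (be (der_be_p hp) (der_be_q hq) x); last by exists u, x.
by rewrite /ec_dif /= ec_ga_be0 linear0.
Qed.

Lemma der_be_rel_fun y u v : der_be_rel y u -> der_be_rel y v -> u = v.
Proof.
move=> [x [ex xu]] [z [ez zv]].
have hp0 : p - -1 = p - -1 - 1 + 1 by lia.
have hq0 : q - 1 = q - 1 + 0 by lia.
have /(ec_ga_al hp0 hq0)[t et] :
  al (index_prev (-1) p) (index_prev 1 q) (x - z) = 0.
  by rewrite linearB ex ez subrr.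
have hp1 : p' = p - -1 - 1 + s.+1%:Z by lia.
have hq1 : q' = q - 1 + (1 - s.+1%:Z) by lia.
apply/(birepr_eq hp1 hq1 xu zv); exists t.
by rewrite (ec_difE _ _ hp0 hq0 (der_be_p hp) (der_be_q hq)) et linearB.
Qed.

Lemma der_be_rel_lin a y y' u u' : der_be_rel y u -> der_be_rel y' u' ->
  der_be_rel (a *: y + y') (a *: u + u').
Proof.
move=> [x [ex xu]] [z [ez zv]]; exists (a *: x + z).
by rewrite !linearP ex ez; split=> //; exact: repr_lin.
Qed.

End DerBe.

Definition der_be : bihom s.+1%:Z (- s.+1%:Z) der_D der_E :=
  fun p q p' q' hp hq => graph_map (der_be_rel_tot hp hq)
    (@der_be_rel_fun _ _ _ _ hp hq) (@der_be_rel_lin _ _ _ _ hp hq).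

Section DerGa.
Variables (p q p' q' : int) (hp : p' = p + 1) (hq : q' = q + 0).

(* [x] |-> ga x *)
Definition der_ga_rel (u : der_E p q) (y : der_D p' q') : Prop :=
  exists x, rep x u /\ ga hp hq x = subval y.

Lemma der_ga_rel_ex u x : rep x u ->
  exists y : der_D p' q', ga hp hq x = subval y.
Proof.
move=> xu.
suff gx : ga hp hq x \in biimage al p' q' by exists (Submod gx).
apply/(biimageP al (index_prev (-1) p') (index_prev 1 q')).
apply/(ec_al_be _ _ (erefl (p' + s%:Z)) (erefl (q' + - s%:Z))).
have hp1 : p' + s%:Z = p + s.+1%:Z by lia.
have hq1 : q' + - s%:Z = q + (1 - s.+1%:Z) by lia.
by have := birepr_cycle hp1 hq1 xu; rewrite (ec_difE _ _ hp hq erefl erefl).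
Qed.

Lemma der_ga_rel_tot u : exists y, der_ga_rel u y.
Proof.
have [x xu] : exists x, rep x u := repr_surj u.
by have [y xy] := der_ga_rel_ex xu; exists y, x.
Qed.

Lemma der_ga_rel_fun u y z : der_ga_rel u y -> der_ga_rel u z -> y = z.
Proof.
move=> [x [xu ex]] [w [wu ew]]; apply: submod_inj; rewrite /= -ex -ew.
have [t et] := (birepr_eq (index_prev s.+1 p) (index_prev (1 - s.+1%:Z) q)
  xu wu).1 erefl.
by apply/eqP; rewrite -subr_eq0 -linearB -et /ec_dif /= ec_ga_be0.
Qed.

Lemma der_ga_rel_lin a u u' y y' : der_ga_rel u y -> der_ga_rel u' y' ->
  der_ga_rel (a *: u + u') (a *: y + y').
Proof.
move=> [x [xu ex]] [w [wu ew]]; exists (a *: x + w).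
by rewrite !linearP ex ew; split=> //; exact: repr_lin.
Qed.

End DerGa.

Definition der_ga : bihom 1 0 der_E der_D :=
  fun p q p' q' hp hq => graph_map (der_ga_rel_tot hp hq)
    (@der_ga_rel_fun _ _ _ _ hp hq) (@der_ga_rel_lin _ _ _ _ hp hq).

Lemma der_beE (p0 q0 p q p' q' : int) (hp0 : p = p0 + -1) (hq0 : q = q0 + 1)
    (hp : p' = p + s.+1%:Z) (hq : q' = q + - s.+1%:Z)
    (hp1 : p' = p0 + s%:Z) (hq1 : q' = q0 + - s%:Z) x (y : der_D p q) :
  al hp0 hq0 x = subval y -> rep (be hp1 hq1 x) (der_be hp hq y).
Proof.
have e0 : p0 = p - -1 by lia.
have e1 : q0 = q - 1 by lia.
subst p0 q0 => ex.
have [|u xu] := @birepr_ex _ _ _ (ec_dif C) p' q' _ _ erefl erefl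
  (be hp1 hq1 x); first by rewrite /ec_dif /= ec_ga_be0 linear0.
suff -> : der_be hp hq y = u by [].
apply: graph_mapE; exists x.
rewrite (eq_irrelevance (index_prev (-1) p) hp0).
rewrite (eq_irrelevance (index_prev 1 q) hq0); split=> //.
by rewrite (eq_irrelevance (der_be_p hp) hp1) (eq_irrelevance (der_be_q hq) hq1).
Qed.

Lemma der_gaE p q p' q' (hp : p' = p + 1) (hq : q' = q + 0) x u :
  rep x u -> subval (der_ga hp hq u) = ga hp hq x.
Proof.
move=> xu; have [y ey] := der_ga_rel_ex hp hq xu.
suff -> : der_ga hp hq u = y by [].
by apply: graph_mapE; exists x.
Qed.

Lemma der_al_be : biexact der_al der_be.
Proof.
move=> p0 q0 p q p1 q1 hp hq hp1 hq1 y.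
have /(biimageP al hp hq)[x ex] := subvalP y.
have hp2 : p1 = p0 + s%:Z by lia.
have hq2 : q1 = q0 + - s%:Z by lia.
have hp3 : p0 = p0 - 1 + 1 by lia.
have hq3 : q0 = q0 + 0 by lia.
have hp4 : p1 = p0 - 1 + s.+1%:Z by lia.
have hq4 : q1 = q0 + (1 - s.+1%:Z) by lia.
rewrite (birepr0 hp4 hq4 (der_beE hp1 hq1 hp2 hq2 ex)); split.
  move=> [t]; rewrite (ec_difE _ _ hp3 hq3 hp2 hq2) => et.
  have /(biimageP al (index_prev _ _) (index_prev _ _)) xt :
      exists w, al (index_prev (-1) p0) (index_prev 1 q0) w = x - ga hp3 hq3 t.
    by apply/(ec_al_be _ _ hp2 hq2); rewrite linearB et subrr.
  exists (Submod xt); apply: submod_inj.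
  by rewrite /= linearB ec_al_ga0 subr0.
move=> [z ez].
have /(ec_ga_al hp3 hq3)[t et] : al hp hq (x - subval z) = 0.
  by rewrite linearB ex -ez /= subrr.
exists t; rewrite (ec_difE _ _ hp3 hq3 hp2 hq2) et linearB.
suff -> : be hp2 hq2 (subval z) = 0 by rewrite subr0.
have /(biimageP al (index_prev _ _) (index_prev _ _))[w <-] := subvalP z.
exact: ec_be_al0.
Qed.

Lemma der_be_ga : biexact der_be der_ga.
Proof.
move=> p0 q0 p q p1 q1 hp hq hp1 hq1 u.
have hp2 : p = p0 + 1 + s%:Z by lia.
have hq2 : q = q0 - 1 + - s%:Z by lia.
have hp3 : p0 = p0 + 1 + -1 by lia.
have hq3 : q0 = q0 - 1 + 1 by lia.
split.
  have [x xu] : exists x, rep x u := repr_surj u.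
  move/(congr1 (@subval _ _ _)); rewrite (der_gaE _ _ xu) linear0.
  move/(ec_be_ga hp2 hq2)=> [w ew]; subst x.
  have yP : al hp3 hq3 w \in biimage al p0 q0 by apply/(biimageP al hp3 hq3); exists w.
  exists (Submod yP).
  by apply: (repr_fun _ xu); apply: der_beE.
move=> [y <-].
have /(biimageP al hp3 hq3)[x ex] := subvalP y.
apply: submod_inj; rewrite linear0 (der_gaE _ _ (der_beE hp hq hp2 hq2 ex)).
exact: ec_ga_be0.
Qed.

Lemma der_ga_al : biexact der_ga der_al.
Proof.
move=> p0 q0 p q p1 q1 hp hq hp1 hq1 y; split.
  move/(congr1 (@subval _ _ _)); rewrite linear0 /=.
  move/(ec_ga_al hp hq)=> [x ex].
  have [|u xu] := @birepr_ex _ _ _ (ec_dif C) p0 q0 (p0 + s.+1%:Z)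
    (q0 + (1 - s.+1%:Z)) erefl erefl x.
    have hp2 : p0 + s.+1%:Z = p + s%:Z by lia.
    have hq2 : q0 + (1 - s.+1%:Z) = q + - s%:Z by lia.
    rewrite (ec_difE _ _ hp hq hp2 hq2) ex.
    have /(biimageP al (index_prev _ _) (index_prev _ _))[w <-] := subvalP y.
    exact: ec_be_al0.
  by exists u; apply: submod_inj; rewrite /= (der_gaE hp hq xu) ex.
move=> [u <-]; have [x xu] : exists x, rep x u := repr_surj u.
by apply: submod_inj; rewrite linear0 /= (der_gaE hp hq xu) ec_al_ga0.
Qed.

Definition derived_couple : exact_couple s.+1 :=
  ExactCouple der_al_be der_be_ga der_ga_al.

End Derived.

Fixpoint iter_derived (C : exact_couple 0) (s : nat) : exact_couple s :=
  match s with
  | 0 => C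
  | s'.+1 => derived_couple (iter_derived C s')
  end.

Definition couple_ss (C : exact_couple 0) : spectral_sequence :=
  SpectralSequence (ss_page := fun r => ec_E (iter_derived C r))
    (ss_dif := fun r => @ec_dif r (iter_derived C r))
    (fun r => @ec_difK r (iter_derived C r))
    (ss_iso := fun r p q => idfun)
    (fun r p q => Bijective (fun=> erefl) (fun=> erefl)).

End Bigraded.

Section FilteredComplex.
Variable k : fieldType.

Record filtration (M : complex k) := Filtration {
  fil :> int -> forall n, submodClosed (M n);
  fil_decr : forall p n x, x \in fil (p + 1) n -> x \in fil p n;
  fil_dif : forall p n n' (e : n' = n + 1) x,
    x \in fil p n -> cdif M e x \in fil p n' }.

Variables (M : complex k) (F : filtration M).

Lemma fil_le p p' n x : p' <= p -> x \in F p n -> x \in F p' n.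
Proof.
move=> le; have [m ->] : exists m : nat, p = p' + m%:Z by exists `|p - p'|%N; lia.
elim: m => [|m IH] xF; first by rewrite addr0 in xF.
apply: IH; apply: fil_decr.
by have <- : p' + m.+1%:Z = p' + m%:Z + 1 by lia.
Qed.

Lemma fil_difK p n n' n'' (e : n' = n + 1) (e' : n'' = n' + 1)
    (x : submod (F p n)) :
  restrict (@fil_dif M F p _ _ e')
    (restrict (@fil_dif M F p _ _ e) x) = 0.
Proof. by apply: submod_inj; rewrite linear0 /= cdifK. Qed.

Definition fil_complex (p : int) : complex k :=
  Complex (cobj := fun n => submod (F p n)) (@fil_difK p).

Definition gr_sub (p n : int) : submodClosed (submod (F p n)) :=
  premod (@subval k (M n) (F p n)) (F (p + 1) n).

Lemma gr_sub_dif p n n' (e : n' = n + 1) (x : fil_complex p n) :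
  x \in gr_sub p n -> cdif (fil_complex p) e x \in gr_sub p n'.
Proof. by move/mk_submodE=> xF; apply/mk_submodE; exact: fil_dif. Qed.

Lemma gr_difK p n n' n'' (e : n' = n + 1) (e' : n'' = n' + 1)
    (x : quotmod (gr_sub p n)) :
  quot_map (@gr_sub_dif p _ _ e')
    (quot_map (@gr_sub_dif p _ _ e) x) = 0.
Proof.
have [z <-] := quot_pi_surj x.
by rewrite !quot_mapE cdifK linear0.
Qed.

(* F^p M / F^{p+1} M *)
Definition gr_complex (p : int) : complex k :=
  Complex (cobj := fun n => quotmod (gr_sub p n)) (@gr_difK p).

Section Inclusion.
Variables (p p' : int) (le : p' <= p).

Lemma fil_incl_mem n x : x \in F p n -> idfun x \in F p' n.
Proof. exact: fil_le. Qed.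

Lemma fil_inclE n n' (e : n' = n + 1) (x : fil_complex p n) :
  restrict (@fil_incl_mem n') (cdif (fil_complex p) e x) =
  cdif (fil_complex p') e (restrict (@fil_incl_mem n) x).
Proof. exact: submod_inj. Qed.

Definition fil_incl : chain_map (fil_complex p) (fil_complex p') :=
  @ChainMap k (fil_complex p) (fil_complex p')
    (fun n => restrict (@fil_incl_mem n)) fil_inclE.

Lemma fil_projE n n' (e : n' = n + 1) (x : fil_complex p n) :
  (quot_pi (gr_sub p' n') \o fil_incl n') (cdif (fil_complex p) e x) =
  cdif (gr_complex p') e ((quot_pi (gr_sub p' n) \o fil_incl n) x).
Proof. by rewrite [RHS]quot_mapE -fil_inclE. Qed.

(* F^p M -> F^p' M / F^{p'+1} M *)
Definition fil_proj : chain_map (fil_complex p) (gr_complex p') :=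
  @ChainMap k (fil_complex p) (gr_complex p')
    (fun n => quot_pi (gr_sub p' n) \o fil_incl n) fil_projE.

End Inclusion.

Lemma fil_short_exact p1 p p' (e1 : p1 = p + 1) (e : p' = p)
    (le1 : p <= p1) (le : p' <= p) :
  short_exact (fil_incl le1) (fil_proj le).
Proof.
subst p1 p'; split=> n.
- by move=> x y /(congr1 (@subval _ _ _)) /= xy; exact: submod_inj.
- move=> y; split.
    rewrite /= -[RHS](linear0 (quot_pi (gr_sub p n))) => /quot_piE.
    rewrite subr0 => /mk_submodE /= yF; exists (Submod yF); exact: submod_inj.
  move=> [x <-]; rewrite /= -[RHS](linear0 (quot_pi (gr_sub p n))).
  by apply/quot_piE; rewrite subr0; apply/mk_submodE; exact: subvalP.
- move=> z; have [y <-] := quot_pi_surj z; exists y.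
  by congr (quot_pi _ _); exact: submod_inj.
Qed.

(* The exact couple of the long exact sequences of
   0 -> F^{p+1} M -> F^p M -> F^p M / F^{p+1} M -> 0, for all p at once; in the
   complex (+)_p F^p M h^{-p}, the term F^p M^{p+q} h^{-p} has bidegree (p, q),
   and al below is induced by h : F^p M h^{-p} -> F^{p-1} M h^{-(p-1)}. *)
Definition fil_D : bimod k := fun p q => cohomology (fil_complex p) (p + q).
Definition fil_E : bimod k := fun p q => cohomology (gr_complex p) (p + q).

Lemma al_le (p p' : int) : p' = p + -1 -> p' <= p. Proof. by lia. Qed.
Lemma al_deg (p q p' q' : int) : p' = p + -1 -> q' = q + 1 -> p + q = p' + q'.
Proof. by lia. Qed.
Lemma be_le (p p' : int) : p' = p + 0%N%:Z -> p' <= p. Proof. by lia. Qed.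
Lemma be_deg (p q p' q' : int) :
  p' = p + 0%N%:Z -> q' = q + - 0%N%:Z -> p + q = p' + q'.
Proof. by lia. Qed.
Lemma ga_le (p p' : int) : p' = p + 1 -> p <= p'. Proof. by lia. Qed.
Lemma ga_deg (p q p' q' : int) :
  p' = p + 1 -> q' = q + 0 -> p' + q' = p + q + 1.
Proof. by lia. Qed.

Definition fil_al : bihom (-1) 1 fil_D fil_D := fun p q p' q' hp hq =>
  cohomology_map (fil_incl (al_le hp)) (al_deg hp hq).
Definition fil_be : bihom 0%N%:Z (- 0%N%:Z) fil_D fil_E := fun p q p' q' hp hq =>
  cohomology_map (fil_proj (be_le hp)) (be_deg hp hq).
Definition fil_ga : bihom 1 0 fil_E fil_D := fun p q p' q' hp hq =>
  connecting (fil_short_exact hp erefl (ga_le hp) (lexx p)) (ga_deg hp hq).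

Lemma fil_al_be : biexact fil_al fil_be.
Proof.
move=> p0 q0 p q p1 q1 hp hq hp1 hq1 y; rewrite /fil_al /fil_be.
move: (al_le hp) (be_le hp1) (al_deg hp hq) (be_deg hp1 hq1) => le le1 e e1.
have h0 : p0 = p + 1 by lia.
have h1 : p1 = p by lia.
clear hp hq hp1 hq1; rewrite /fil_D /fil_E in y *.
move: y; case: _ / e1; subst p1.
move: e; move: (p0 + q0) => n0 e; subst n0 => y.
exact: (les_mid (fil_short_exact h0 erefl le le1)).
Qed.

Lemma fil_be_ga : biexact fil_be fil_ga.
Proof.
move=> p0 q0 p q p1 q1 hp hq hp1 hq1 y; rewrite /fil_be /fil_ga.
move: (ga_deg hp1 hq1) (be_le hp) (be_deg hp hq) => e1 le e.
have h0 : p0 = p by lia.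
clear hp hq hq1; subst p0; rewrite (bool_irrelevance le (lexx p)).
rewrite /fil_E /fil_D in y *; move: e1 y; case: _ / e => e1 y.
exact: les_right.
Qed.

Lemma fil_ga_al : biexact fil_ga fil_al.
Proof.
move=> p0 q0 p q p1 q1 hp hq hp1 hq1 y; rewrite /fil_ga /fil_al.
move: (al_le hp1) (al_deg hp1 hq1) (ga_deg hp hq) => le e1 e.
have h0 : p1 = p0 by lia.
clear hq hp1 hq1; subst p1; rewrite (bool_irrelevance le (ga_le hp)).
rewrite /fil_D /fil_E in y *; move: e y; case: _ / e1 => e y.
exact: les_left.
Qed.

Definition fil_couple : exact_couple k 0 :=
  ExactCouple fil_al_be fil_be_ga fil_ga_al.

(* ss_page (fil_ss F) 0 p q is H^{p+q}(F^p M / F^{p+1} M). *)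
Definition fil_ss : spectral_sequence k := couple_ss fil_couple.

End FilteredComplex.

(* Main.v *)
From HB Require Import structures.
Require Import Defs.
From mathcomp Require Import all_boot all_order all_algebra boolp zify.
From mathcomp Require classical_sets.
Set Implicit Arguments.
Unset Strict Implicit.
Unset Printing Implicit Defensive.
Import Order.TTheory GRing.Theory.
Local Open Scope ring_scope.

(** All the differentials of E can be made to act on the first page at once.
Over a field the projection from the cycles of E_r onto E_{r+1} has a linear
section (page_lift) and extends linearly to all of E_r (page_class). Composing
these down to the first page gives s_r : E_r -> E_1 with a left inverse
c_r : E_1 -> E_r, and the operator D_r = s_r d_r c_r on E_1, of the bidegree of
d_r. A lift consists of cycles and the extended class map kills boundaries, so
D_s D_r = 0 for all r and s, not only for r = s (total_difK). For the same
reason D_i s_r = 0 for every i < r, while D_r s_r = s_r d_r.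

Take for M^n the families (y_p) with y_p in E_1^{p,n-p} that vanish for p small
enough, filtered by the index below which they vanish, with differential
D_1 + D_2 + ... . Each component of this sum is finite because families are
bounded below; allowing infinitely many components upwards is what makes room
for infinitely many nonzero D_r. The differential strictly raises the
filtration, so the first page is the associated graded E_1 itself.

On later pages, let x be in E_r^{p,q} and put y = s_r x, as a family concentrated
in filtration degree p. Its differential has no component before degree p + r,
where it has D_r y = s_r (d_r x). In the spectral sequence of any filtered
complex, an element y whose differential lies in F^{p+r} has that differential as
a representative of d_r [y], and only the leading component of a representative
matters (page_repr_dif, page_repr_lead). Hence the class of s_r x is sent by d_r
to the class of s_r (d_r x). The isomorphisms of pages are built by recursion: the
one on E_{r+1} is forced to be the map induced on homology by the one on E_r,
and the invariant matches_lift, that the class of s_r x goes to x, is what gives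
the compatibility with d_r (matches_lift_dif) and passes to the next page. *)

(** * Linear splittings over a field *)

Section Splitting.
Variables (k : fieldType) (V : lmodType k).

(** By Zorn, a submodule maximal among those meeting S trivially. *)
Lemma submod_complement (S : submodClosed V) :
  exists C : submodClosed V, (forall x, x \in S -> x \in C -> x = 0) /\
    forall v, exists2 s, s \in S & v - s \in C.
Proof.
pose P (A : V -> Prop) := (forall a x y, A x -> A y -> A (a *: x + y)) /\
  forall x, x \in S -> A x -> x = 0.
have [F FP Ftot|A [[Alin AS] Amax]] := @classical_sets.Zorn_bigcup V P.
  split=> [a x y [X FX Xx] [Y FY Yy]|x Sx [X FX Xx]]; last exact: (FP X FX).2.
  have [XY|YX] := Ftot X Y FX FY.
    by exists Y => //; apply: (FP Y FY).1 => //; exact: XY.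
  by exists X => //; apply: (FP X FX).1 => //; exact: YX.
(* P also holds for the empty set, which maximality excludes. *)
have A0 : A 0.
  apply: contrapT => nA0; apply: (Amax (fun x => x = 0)).
    split=> [x Ax|sub0]; last by apply: nA0; exact: sub0.
    by case: nA0; rewrite -[0](addNr x) -scaleN1r; exact: Alin.
  by split=> [a x y -> ->|//]; rewrite scaler0 addr0.
have AZ a x : A x -> A (a *: x).
  by move=> Ax; rewrite -[_ *: _]addr0; exact: Alin.
exists (mk_submod A0 Alin); split=> [x Sx /mk_submodE Ax|v]; first exact: AS.
apply: contrapT => nv.
have nAS s : s \in S -> ~ A (v - s).
  by move=> Ss Avs; apply: nv; exists s => //; apply/mk_submodE.
(* A would extend to the larger A + k v. *)
apply: (Amax (fun x => exists c, A (x - c *: v))).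
  split=> [x Ax|subA]; first by exists 0; rewrite scale0r subr0.
  apply: (nAS 0); rewrite ?rpred0 // subr0; apply: subA.
  by exists 1; rewrite scale1r subrr.
split=> [a x y [c Ac] [c' Ac']|x Sx [c Ac]].
  exists (a * c + c'); have := Alin a _ _ Ac Ac'.
  by rewrite scalerBr scalerA scalerDl opprD addrACA.
have [c0|c0] := eqVneq c 0.
  by rewrite c0 scale0r subr0 in Ac; exact: AS.
case: (nAS (c^-1 *: x)); first exact: rpredZ.
have := AZ (- c^-1) _ Ac.
by rewrite scalerBr !scaleNr opprK addrC scalerA mulVf ?scale1r.
Qed.

Lemma submod_retraction (S : submodClosed V) :
  exists f : {linear V -> submod S}, forall x, f (subval x) = x.
Proof.
have [C [CS Csum]] := submod_complement S.
pose R (v : V) (s : submod S) := v - subval s \in C.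
have Rtot v : exists s, R v s.
  by have [s Ss Cs] := Csum v; exists (Submod Ss).
have Rfun v s t : R v s -> R v t -> s = t.
  move=> Cs Ct; apply: submod_inj; apply/eqP; rewrite -subr_eq0; apply/eqP/CS.
    by rewrite -linearB; exact: subvalP.
  have -> : subval s - subval t = (v - subval t) - (v - subval s).
    by rewrite opprB [RHS]addrC subrKA.
  by rewrite -[- (v - _)]scaleN1r rpredD // rpredZ.
have Rlin a u v s t : R u s -> R v t -> R (a *: u + v) (a *: s + t).
  move=> us vt; rewrite /R [subval _]linearP opprD addrACA -scalerBr.
  by rewrite rpredD // rpredZ.
exists (graph_map Rtot Rfun Rlin) => x; apply: graph_mapE.
by rewrite /R subrr rpred0.
Qed.

(** The representative of a class is the one killed by a retraction onto S. *)
Lemma quot_section (S : submodClosed V) :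
  exists f : {linear quotmod S -> V}, forall u, quot_pi S (f u) = u.
Proof.
have [f fK] := submod_retraction S.
pose R (u : quotmod S) (x : V) := quot_pi S x = u /\ f x = 0.
have Rtot u : exists x, R u x.
  have [x <-] := quot_pi_surj u; exists (x - subval (f x)).
  split; last by rewrite linearB fK subrr.
  by apply/quot_piE; rewrite addrAC subrr add0r -scaleN1r rpredZ //; exact: subvalP.
have Rfun u x y : R u x -> R u y -> x = y.
  move=> [<- fx] [/quot_piE Sxy fy]; apply/esym/eqP; rewrite -subr_eq0.
  have := fK (Submod Sxy); rewrite /= linearB fx fy subrr.
  by move/(congr1 (@subval _ _ _)) => /= <-; rewrite eqxx.
have Rlin a u v x y : R u x -> R v y -> R (a *: u + v) (a *: x + y).
  by move=> [<- fx] [<- fy]; split; rewrite linearP // fx fy scaler0 addr0.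
exists (graph_map Rtot Rfun Rlin) => u.
by have [] := graph_mapP Rtot Rfun Rlin u.
Qed.
End Splitting.

(** Cycles representing the classes can be chosen linearly, and the class map
extends from the cycles to the whole of V. *)
Lemma homology_splitting (k : fieldType) (U V W : lmodType k)
    (f : {linear U -> V}) (g : {linear V -> W}) :
  exists (s : {linear homology f g -> V}) (r : {linear V -> homology f g}),
    (forall u, represents (s u) u) /\ forall x u, represents x u -> r x = u.
Proof.
have [s sK] := quot_section (boundary f g).
have [r rK] := submod_retraction (kermod g).
exists (@subval _ _ _ \o s), (quot_pi _ \o r); split=> [u|_ u [z [<- <-]]] /=.
  by exists (s u).
by rewrite rK.
Qed.

(** * The differentials of a spectral sequence, moved to the first page *)

Section SplitPages.
Variables (k : fieldType) (E : spectral_sequence k).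
Local Notation page := (ss_page E).
Local Notation dif := (ss_dif E).

Lemma page_splitting r p q :
  exists f : {linear page r.+1 p q -> page r p q} *
             {linear page r p q -> page r.+1 p q},
    (forall u, represents (f.1 (ss_iso E r p q u)) u) /\
    forall x u, represents x u -> f.2 x = ss_iso E r p q u.
Proof.
have [s [t [sP tP]]] := homology_splitting
  (dif (index_prev r.+1 p) (index_prev (1 - r.+1%:Z) q))
  (dif (erefl (p + r.+1%:Z)) (erefl (q + (1 - r.+1%:Z)))).
have [inv isoK invK] := ss_iso_bij E r p q.
have inv_lin : linear inv.
  by move=> a u v; rewrite -{1}[u]invK -{1}[v]invK -linearP isoK.
pose invL := GRing.isLinear.Build k _ _ _ inv inv_lin.
pose g : {linear _ -> _} := HB.pack inv invL.
pose f1 : {linear page r.+1 p q -> page r p q} := s \o g.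
pose f2 : {linear page r p q -> page r.+1 p q} := ss_iso E r p q \o t.
exists (f1, f2); split=> [u|x u xu] /=.
  by rewrite isoK; exact: sP.
by rewrite (tP _ _ xu).
Qed.

Definition page_lift r p q := (projT1 (cid (page_splitting r p q))).1.
Definition page_class r p q := (projT1 (cid (page_splitting r p q))).2.

Lemma page_liftP r p q u : represents (page_lift r p q (ss_iso E r p q u)) u.
Proof. by rewrite /page_lift; case: cid => f [? ?] /=. Qed.

Lemma page_classP r p q x (u : bihomology (@ss_dif _ E r) p q) :
  represents x u -> page_class r p q x = ss_iso E r p q u.
Proof. by rewrite /page_class; case: cid => f [? H] /=; exact: H. Qed.

Lemma page_liftK r p q : cancel (page_lift r p q) (page_class r p q).
Proof.
move=> e; have [inv _ invK] := ss_iso_bij E r p q.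
by rewrite -{1}[e]invK (page_classP (page_liftP _)) invK.
Qed.

(** Lifts are cycles and boundaries have class 0: these two facts make the
operators total_dif compose to 0. *)
Lemma dif_page_lift r (p q p' q' : int) (hp : p' = p + r.+1%:Z)
    (hq : q' = q + (1 - r.+1%:Z)) e : dif hp hq (page_lift r p q e) = 0.
Proof.
have [inv _ invK] := ss_iso_bij E r p q.
by rewrite -[e]invK; apply: (birepr_cycle hp hq (page_liftP _)).
Qed.

Lemma page_class_dif r (p q p' q' : int) (hp : p' = p + r.+1%:Z)
    (hq : q' = q + (1 - r.+1%:Z)) x : page_class r p' q' (dif hp hq x) = 0.
Proof.
have [|u xu] := @birepr_ex _ _ _ _ (dif (r := r)) p' q' _ _ erefl erefl
  (dif hp hq x).
  exact: ss_difK.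
rewrite (page_classP xu) (_ : u = 0) ?linear0 //.
by apply/(birepr0 hp hq xu); exists x.
Qed.

Fixpoint lift1 r p q : {linear page r p q -> page 0 p q} :=
  if r is r'.+1 then lift1 r' p q \o page_lift r' p q else idfun.

Fixpoint class1 r p q : {linear page 0 p q -> page r p q} :=
  if r is r'.+1 then page_class r' p q \o class1 r' p q else idfun.

Lemma lift1K r p q : cancel (lift1 r p q) (class1 r p q).
Proof. by elim: r => [|r IH] e //=; rewrite IH page_liftK. Qed.

Lemma lift1_factor r s p q e : (r <= s)%N ->
  exists e', lift1 s p q e = lift1 r p q e'.
Proof.
elim: s e => [|s IH] e; first by rewrite leqn0 => /eqP ->; exists e.
rewrite leq_eqVlt => /predU1P[->|]; first by exists e.
by rewrite ltnS => /(IH (page_lift s p q e))[e' He]; exists e'.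
Qed.

Lemma class1_eq0 r s p q x :
  (r <= s)%N -> class1 r p q x = 0 -> class1 s p q x = 0.
Proof.
move=> /subnK <-; elim: (s - r)%N => [//|m IH] x0.
by rewrite addSn /= IH // linear0.
Qed.

(** The differential of page r, carried by the lifts of page r and extended by 0 to
the kernel of class1 r, which is a complement of these lifts. *)
Definition total_dif r : bihom r.+1%:Z (1 - r.+1%:Z) (page 0) (page 0) :=
  fun p q p' q' hp hq => lift1 r p' q' \o (dif hp hq \o class1 r p q).

Lemma total_dif_lift r (p q p' q' : int) (hp : p' = p + r.+1%:Z)
    (hq : q' = q + (1 - r.+1%:Z)) e :
  total_dif hp hq (lift1 r p q e) = lift1 r p' q' (dif hp hq e).
Proof. by rewrite /= lift1K. Qed.

Lemma total_dif_lift0 r s (p q p' q' : int) (hp : p' = p + s.+1%:Z)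
    (hq : q' = q + (1 - s.+1%:Z)) e : (s < r)%N ->
  total_dif hp hq (lift1 r p q e) = 0.
Proof.
move=> /(lift1_factor e)[e' ->]; rewrite total_dif_lift /=.
by rewrite dif_page_lift linear0.
Qed.

(** For s < r the image of total_dif r consists of lifts of lifted cycles of d_s;
for s > r it consists of lifts of boundaries, whose class on page r.+1, and so on
page s, is 0. *)
Lemma total_difK r s (p q p' q' p'' q'' : int) (hp : p' = p + r.+1%:Z)
    (hq : q' = q + (1 - r.+1%:Z)) (hp' : p'' = p' + s.+1%:Z)
    (hq' : q'' = q' + (1 - s.+1%:Z)) x :
  total_dif hp' hq' (total_dif hp hq x) = 0.
Proof.
have [sr|rs|rs] := ltngtP s r; first exact: total_dif_lift0.
- rewrite /= (@class1_eq0 r.+1 s) ?linear0 //=.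
  by rewrite lift1K page_class_dif.
- by subst s; rewrite total_dif_lift ss_difK linear0.
Qed.

End SplitPages.

(** * The complex of families bounded below *)

Section ProductModule.
Variables (k : fieldType) (I : Type) (V : I -> lmodType k).

Definition prodmod : Type := forall i, V i.

HB.instance Definition _ := gen_eqMixin prodmod.
HB.instance Definition _ := gen_choiceMixin prodmod.

Implicit Types x y z : prodmod.

Definition prod_add x y : prodmod := fun i => x i + y i.
Definition prod_scale a x : prodmod := fun i => a *: x i.

Lemma prod_addA : associative prod_add.
Proof. by move=> x y z; apply: functional_extensionality_dep => i; exact: addrA. Qed.
Lemma prod_addC : commutative prod_add.
Proof. by move=> x y; apply: functional_extensionality_dep => i; exact: addrC. Qed.
Lemma prod_add0 : left_id (fun=> 0) prod_add.
Proof. by move=> x; apply: functional_extensionality_dep => i; exact: add0r. Qed.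
Lemma prod_addN : left_inverse (fun=> 0) (fun x i => - x i) prod_add.
Proof. by move=> x; apply: functional_extensionality_dep => i; exact: addNr. Qed.
HB.instance Definition _ :=
  GRing.isZmodule.Build prodmod prod_addA prod_addC prod_add0 prod_addN.

Lemma prod_scaleA a b x : prod_scale a (prod_scale b x) = prod_scale (a * b) x.
Proof. by apply: functional_extensionality_dep => i; exact: scalerA. Qed.
Lemma prod_scale1 : left_id 1 prod_scale.
Proof. by move=> x; apply: functional_extensionality_dep => i; exact: scale1r. Qed.
Lemma prod_scaleDr : right_distributive prod_scale +%R.
Proof. by move=> a x y; apply: functional_extensionality_dep => i; exact: scalerDr. Qed.
Lemma prod_scaleDl x a b : prod_scale (a + b) x = prod_scale a x + prod_scale b x.
Proof. by apply: functional_extensionality_dep => i; exact: scalerDl. Qed.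
HB.instance Definition _ := GRing.Zmodule_isLmodule.Build k prodmod
  prod_scaleA prod_scale1 prod_scaleDr prod_scaleDl.

End ProductModule.

Section LaurentComplex.
Variables (k : fieldType) (V : bimod k).
Variable D : forall r, bihom r.+1%:Z (1 - r.+1%:Z) V V.
Hypothesis DK : forall r s (p q p' q' p'' q'' : int) (hp : p' = p + r.+1%:Z)
  (hq : q' = q + (1 - r.+1%:Z)) (hp' : p'' = p' + s.+1%:Z)
  (hq' : q'' = q' + (1 - s.+1%:Z)) x, D hp' hq' (D hp hq x) = 0.

(** The components of degree n are indexed by the pairs (p, q) on the line
p + q = n, so that they live in V p q without any cast. *)
Definition diagonal (n : int) := {pq : int * int | n == pq.1 + pq.2}.

Definition diag n p q (e : n = p + q) : diagonal n :=
  exist _ (p, q) (introT eqP e).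

Definition family n := prodmod (fun i : diagonal n => V (sval i).1 (sval i).2).

Definition coef n p q (e : n = p + q) (y : family n) : V p q := y (diag e).

Lemma familyP n (y z : family n) :
  (forall p q (e : n = p + q), coef e y = coef e z) -> y = z.
Proof.
move=> yz; apply: functional_extensionality_dep => -[[p q] /= e].
have := yz p q (eqP e); rewrite /coef /diag.
by rewrite (bool_irrelevance (introT eqP (elimT eqP e)) e).
Qed.

Lemma coef_linear n p q (e : n = p + q) : linear (@coef n p q e).
Proof. by []. Qed.
HB.instance Definition _ n p q (e : n = p + q) := GRing.isLinear.Build k _ _ _
  (@coef n p q e) (@coef_linear n p q e).

Definition vanishes_below b n (y : family n) :=
  forall p q (e : n = p + q), p < b -> coef e y = 0.

Lemma vanishes_below0 b n : vanishes_below b (0 : family n).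
Proof. by []. Qed.
Lemma vanishes_belowL b n a (y z : family n) :
  vanishes_below b y -> vanishes_below b z -> vanishes_below b (a *: y + z).
Proof.
by move=> y0 z0 p q e pb; rewrite linearP /= y0 // z0 // scaler0 addr0.
Qed.

Lemma vanishes_belowW b b' n (y : family n) :
  b' <= b -> vanishes_below b y -> vanishes_below b' y.
Proof. by move=> bb' y0 p q e pb; apply: y0; lia. Qed.

Lemma bounded0 n : exists b, vanishes_below b (0 : family n).
Proof. by exists 0; exact: vanishes_below0. Qed.
Lemma boundedL n a (y z : family n) :
  (exists b, vanishes_below b y) -> (exists b, vanishes_below b z) ->
  exists b, vanishes_below b (a *: y + z).
Proof.
move=> [b yb] [c zc]; exists (Num.min b c); apply: vanishes_belowL.
  by apply: vanishes_belowW yb; lia.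
by apply: vanishes_belowW zc; lia.
Qed.

Definition laurent n : submodClosed (family n) := mk_submod (bounded0 n) (@boundedL n).

Lemma laurentP n (y : submod (laurent n)) :
  exists b, vanishes_below b (subval y).
Proof. by have /mk_submodE := subvalP y. Qed.

Lemma deg_prev n n' (p q : int) (r : nat) : n' = n + 1 -> n' = p + q ->
  n = p - r.+1%:Z + (q - (1 - r.+1%:Z)).
Proof. by lia. Qed.

(** The (p, q)-component of the sum of the D r, for r < m only; the indices p and
q are those of the target. *)
Definition partial_dif n n' (e : n' = n + 1) m (y : family n) p q (e' : n' = p + q) :
    V p q :=
  \sum_(r < m) D (index_prev r.+1 p) (index_prev (1 - r.+1%:Z) q)
                 (coef (deg_prev r e e') y).

(** The components of the infinite sum are eventual values of the partial sums.
Requiring equality for all large m, rather than for a cutoff read off a lower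
bound of y, makes linearity immediate: two thresholds have a common bound. *)
Definition dif_rel n n' (e : n' = n + 1) (y : submod (laurent n))
    (z : submod (laurent n')) :=
  forall p q (e' : n' = p + q), exists N, forall m, (N <= m)%N ->
    coef e' (subval z) = partial_dif e m (subval y) e'.

Lemma partial_difE n n' (e : n' = n + 1) b (y : family n) p q (e' : n' = p + q) m :
  vanishes_below b y -> (`|p - b| <= m)%N ->
  partial_dif e m y e' = partial_dif e `|p - b| y e'.
Proof.
move=> yb /subnKC <-; rewrite /partial_dif big_split_ord /= [X in _ + X]big1 ?addr0 //.
by move=> r _; rewrite yb ?linear0 //; lia.
Qed.

Lemma partial_dif_linear n n' (e : n' = n + 1) m p q (e' : n' = p + q) a
    (y z : family n) : partial_dif e m (a *: y + z) e' =
  a *: partial_dif e m y e' + partial_dif e m z e'.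
Proof.
rewrite /partial_dif scaler_sumr -big_split /=; apply: eq_bigr => r _.
by rewrite !linearP.
Qed.

Lemma dif_rel_tot n n' (e : n' = n + 1) y : exists z, @dif_rel n n' e y z.
Proof.
have [b yb] := laurentP y.
pose z : family n' := fun i =>
  partial_dif e `|(sval i).1 - b| (subval y) (eqP (valP i)).
have zE p q (e' : n' = p + q) : coef e' z = partial_dif e `|p - b| (subval y) e'.
  by rewrite /coef /z /=; congr partial_dif; exact: eq_irrelevance.
have zL : z \in laurent n'.
  apply/mk_submodE; exists b => p q e' pb; rewrite zE /partial_dif big1 // => r _.
  by rewrite yb ?linear0 //; lia.
exists (Submod zL) => p q e'; exists `|p - b|%N => m mb.
by rewrite /= zE (partial_difE _ _ yb).
Qed.

Lemma dif_rel_fun n n' (e : n' = n + 1) y z z' :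
  @dif_rel n n' e y z -> @dif_rel n n' e y z' -> z = z'.
Proof.
move=> yz yz'; apply/submod_inj/familyP => p q e'.
have [N zN] := yz p q e'; have [N' zN'] := yz' p q e'.
by rewrite (zN (maxn N N')) ?leq_maxl // (zN' (maxn N N')) ?leq_maxr.
Qed.

Lemma dif_rel_lin n n' (e : n' = n + 1) a y y' z z' :
  @dif_rel n n' e y z -> @dif_rel n n' e y' z' ->
  dif_rel e (a *: y + y') (a *: z + z').
Proof.
move=> yz yz' p q e'; have [N zN] := yz p q e'; have [N' zN'] := yz' p q e'.
exists (maxn N N') => m; rewrite geq_max => /andP[Nm N'm].
by rewrite !linearP partial_dif_linear -zN // -zN'.
Qed.

Definition laurent_dif n n' (e : n' = n + 1) :
    {linear submod (laurent n) -> submod (laurent n')} :=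
  graph_map (dif_rel_tot e) (@dif_rel_fun _ _ e) (@dif_rel_lin _ _ e).

Lemma coef_laurent_dif n n' (e : n' = n + 1) y p q (e' : n' = p + q) :
  exists N, forall m, (N <= m)%N ->
    coef e' (subval (laurent_dif e y)) = partial_dif e m (subval y) e'.
Proof.
by have := graph_mapP (dif_rel_tot e) (@dif_rel_fun _ _ e) (@dif_rel_lin _ _ e) y.
Qed.

Lemma laurent_difK n n' n'' (e : n' = n + 1) (e' : n'' = n' + 1) y :
  laurent_dif e' (laurent_dif e y) = 0.
Proof.
apply/submod_inj/familyP => p q e''.
have [N /(_ _ (leqnn N)) ->] := coef_laurent_dif e' (laurent_dif e y) e''.
rewrite /partial_dif big1 // => s _.
have [m /(_ _ (leqnn m)) ->] := coef_laurent_dif e y (deg_prev s e' e'').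
by rewrite /partial_dif linear_sum big1 // => r _; exact: DK.
Qed.

Definition laurent_complex : complex k :=
  Complex (cobj := fun n => submod (laurent n)) laurent_difK.

Lemma laurent_dif_below n n' (e : n' = n + 1) b (y : laurent_complex n) :
  vanishes_below b (subval y) ->
  vanishes_below (b + 1) (subval (cdif laurent_complex e y)).
Proof.
move=> yb p q e' pb.
have [N /(_ _ (leqnn N)) ->] := coef_laurent_dif e y e'.
by rewrite /partial_dif big1 // => r _; rewrite yb ?linear0 //; lia.
Qed.

Definition laurent_fil_sub (b n : int) : submodClosed (laurent_complex n) :=
  premod (@subval _ _ (laurent n))
    (mk_submod (@vanishes_below0 b n) (@vanishes_belowL b n)).

Lemma laurent_filP b n (y : laurent_complex n) :
  y \in laurent_fil_sub b n <-> vanishes_below b (subval y).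
Proof.
split; first by move/mk_submodE/mk_submodE.
by move=> yb; apply/mk_submodE/mk_submodE.
Qed.

Lemma laurent_fil_decr p n y :
  y \in laurent_fil_sub (p + 1) n -> y \in laurent_fil_sub p n.
Proof.
by move/laurent_filP => yp; apply/laurent_filP; apply: vanishes_belowW yp; lia.
Qed.

Lemma laurent_fil_dif p n n' (e : n' = n + 1) y : y \in laurent_fil_sub p n ->
  cdif laurent_complex e y \in laurent_fil_sub p n'.
Proof.
move/laurent_filP/(laurent_dif_below e) => dy; apply/laurent_filP.
by apply: vanishes_belowW dy; lia.
Qed.

Definition laurent_fil : filtration laurent_complex :=
  Filtration laurent_fil_decr laurent_fil_dif.

(** Every D r raises p by at least 1, so the differential of the associated graded
complex vanishes. *)
Lemma laurent_fil_dif1 p n n' (e : n' = n + 1) y : y \in laurent_fil p n ->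
  cdif laurent_complex e y \in laurent_fil (p + 1) n'.
Proof. by move/laurent_filP/(laurent_dif_below e)/laurent_filP. Qed.

Section Single.
Variables (n p q : int) (e : n = p + q).

Definition single_family (x : V p q) : family n :=
  @dfwith (diagonal n) (fun i => V (sval i).1 (sval i).2) (fun=> 0) (diag e) x.

Lemma coef_single x (e' : n = p + q) : coef e' (single_family x) = x.
Proof. by rewrite (eq_irrelevance e' e); exact: dfwith_in. Qed.

Lemma coef_single0 x p' q' (e' : n = p' + q') :
  p' != p -> coef e' (single_family x) = 0.
Proof.
move=> pp'; apply: dfwith_out; apply: contraNneq pp'.
by move/(congr1 (fun i => (sval i).1)) => /= ->.
Qed.

Lemma single_below x : vanishes_below p (single_family x).
Proof. by move=> p' q' e' lt; apply: coef_single0; lia. Qed.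

Lemma single_laurent x : single_family x \in laurent n.
Proof. by apply/mk_submodE; exists p; exact: single_below. Qed.

Definition single x : laurent_complex n := Submod (single_laurent x).

Lemma single_linear : linear single.
Proof.
move=> a x y; apply/submod_inj/familyP => p' q' e'; rewrite !linearP /=.
have [pp|pp] := eqVneq p' p; last by rewrite !coef_single0 // scaler0 addr0.
have qq : q' = q by lia.
by subst p' q'; rewrite !coef_single.
Qed.
HB.instance Definition _ := GRing.isLinear.Build k _ _ _ single single_linear.

Lemma single_fil x : single x \in laurent_fil p n.
Proof. by apply/laurent_filP; exact: single_below. Qed.

Lemma single_lead (y : laurent_complex n) : y \in laurent_fil p n ->
  y - single (coef e (subval y)) \in laurent_fil (p + 1) n.
Proof.
move/laurent_filP => yp; apply/laurent_filP => p' q' e' lt; rewrite !linearB /=.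
have [pp|pp] := eqVneq p' p.
  have qq : q' = q by lia.
  by subst p' q'; rewrite coef_single (eq_irrelevance e' e) subrr.
by rewrite coef_single0 // yp ?subrr //; lia.
Qed.

End Single.

Lemma coef_dif_single n n' (en : n' = n + 1) r (p q p' q' : int) (e : n = p + q)
    (e' : n' = p' + q') (hp : p' = p + r.+1%:Z) (hq : q' = q + (1 - r.+1%:Z)) x :
  coef e' (subval (cdif laurent_complex en (single e x))) = D hp hq x.
Proof.
have [N Nd] := coef_laurent_dif en (single e x) e'.
have lt : (r < N + r.+1)%N by lia.
rewrite (Nd (N + r.+1)%N) ?leq_addr // /partial_dif (bigD1 (Ordinal lt)) //=.
rewrite [X in _ + X]big1 ?addr0 => [|s sr]; last first.
  by rewrite coef_single0 ?linear0 //; move: sr; rewrite -val_eqE /=; lia.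
move: (deg_prev _ _ _) (index_prev _ p') (index_prev _ q').
have -> : p' - r.+1%:Z = p by lia.
have -> : q' - (1 - r.+1%:Z) = q by lia.
move=> e1 hp1 hq1.
by rewrite (eq_irrelevance hp1 hp) (eq_irrelevance hq1 hq) coef_single.
Qed.

(** If x is killed by the D s with s < r, then the differential of x starts with
D r x. *)
Lemma dif_single n n' (en : n' = n + 1) r (p q p' q' : int) (e : n = p + q)
    (e' : n' = p' + q') (hp : p' = p + r.+1%:Z) (hq : q' = q + (1 - r.+1%:Z)) x :
  (forall s p1 q1 (hp1 : p1 = p + s.+1%:Z) (hq1 : q1 = q + (1 - s.+1%:Z)),
     (s < r)%N -> D hp1 hq1 x = 0) ->
  cdif laurent_complex en (single e x) \in laurent_fil p' n' /\
  cdif laurent_complex en (single e x) - single e' (D hp hq x)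
    \in laurent_fil (p' + 1) n'.
Proof.
move=> x0; set y := cdif _ _ _; have yF : y \in laurent_fil p' n'.
  apply/laurent_filP => p1 q1 e1 lt.
  have [le|gt] := boolP (p1 <= p).
    by apply: (laurent_dif_below en (y := single e x) (single_below e x)); lia.
  have hp1 : p1 = p + (`|p1 - p|.-1).+1%:Z by lia.
  have hq1 : q1 = q + (1 - (`|p1 - p|.-1).+1%:Z) by lia.
  by rewrite (coef_dif_single _ _ _ hp1 hq1) x0 //; lia.
by split=> //; rewrite -(coef_dif_single en e e'); exact: single_lead.
Qed.

End LaurentComplex.

(** * Representatives in the spectral sequence of a filtered complex *)

Section Representatives.
Variables (k : fieldType) (M : complex k) (F : filtration M).
Local Notation couple r := (iter_derived (fil_couple F) r).

(** The same element of the complex is read in several bidegrees (p, q) of the same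
total degree, which is p + q only up to a proof. *)
Definition repr_at (C : complex k) n m (e : n = m) (x : C n) :
    cohomology C m -> Prop :=
  match e in _ = m' return cohomology C m' -> Prop with
  | erefl => fun u => cohom_repr x u
  end.

Lemma repr_at_map (A B : complex k) (h : chain_map A B) n m m'
    (e : n = m) (e' : n = m') (e1 : m = m') (x : A n) u :
  repr_at e x u -> repr_at e' (h n x) (cohomology_map h e1 u).
Proof.
case: m / e e1 u => e1 u; case: m' / e' e1 => e1.
exact: cohomology_mapE.
Qed.

Lemma repr_at_fun (C : complex k) n m (e : n = m) (x : C n) (u v : cohomology C m) :
  repr_at e x u -> repr_at e x v -> u = v.
Proof. by subst m; exact: repr_fun. Qed.

Lemma repr_at_lin (C : complex k) n m (e : n = m) a (x y : C n) u v :
  repr_at e x u -> repr_at e y v -> repr_at e (a *: x + y) (a *: u + v).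
Proof. by subst m; exact: repr_lin. Qed.

Lemma repr_at_eq (C : complex k) n0 n m (e0 : n = n0 + 1) (e : n = m) (x y : C n)
    (u v : cohomology C m) : repr_at e x u -> repr_at e y v ->
  u = v <-> exists t, cdif C e0 t = x - y.
Proof. by subst m; exact: cohom_eq. Qed.

Lemma repr_at_ex (C : complex k) n n' m (e' : n' = n + 1) (e : n = m) (x : C n) :
  cdif C e' x = 0 -> exists u : cohomology C m, repr_at e x u.
Proof. by subst m; exact: cohom_ex. Qed.

Lemma repr_at_surj (C : complex k) n m (e : n = m) (u : cohomology C m) :
  exists x, repr_at e x u.
Proof. by subst m; exact: repr_surj. Qed.

Definition fil_class n p q (e : n = p + q) (z : M n) (x : fil_D F p q) :=
  exists zF : fil_complex F p n, subval zF = z /\ repr_at e zF x.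

Definition gr_class n p q (e : n = p + q) (y : M n) (u : fil_E F p q) :=
  exists yF : fil_complex F p n,
    subval yF = y /\ repr_at (C := gr_complex F p) e (quot_pi _ yF) u.

Lemma fil_class_fun n p q (e : n = p + q) z (x x' : fil_D F p q) :
  fil_class e z x -> fil_class e z x' -> x = x'.
Proof.
move=> [zF [ez zx]] [zF' [ez' zx']]; apply: repr_at_fun zx _.
by rewrite (_ : zF = zF') //; apply: submod_inj; rewrite ez.
Qed.

Lemma fil_class_ex n n' p q (e' : n' = n + 1) (e : n = p + q) z :
  z \in F p n -> cdif M e' z = 0 -> exists x : fil_D F p q, fil_class e z x.
Proof.
move=> zF dz; have [|x zx] := @repr_at_ex (fil_complex F p) _ _ _ e' e (Submod zF).
  by apply: submod_inj; rewrite linear0.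
by exists x, (Submod zF).
Qed.

Lemma fil_class_al n p q p' q' (hp : p' = p + -1) (hq : q' = q + 1)
    (e : n = p + q) (e' : n = p' + q') z x :
  fil_class e z x -> fil_class e' z (fil_al F hp hq x).
Proof.
move=> [zF [ez zx]]; exists (fil_incl F (al_le hp) n zF); split=> //.
exact: repr_at_map zx.
Qed.

Lemma fil_class_be n p q p' q' (hp : p' = p + 0%N%:Z) (hq : q' = q + - 0%N%:Z)
    (e : n = p + q) (e' : n = p' + q') z x :
  fil_class e z x -> gr_class e' z (fil_be F hp hq x).
Proof.
move=> [zF [ez zx]]; exists (fil_incl F (be_le hp) n zF); split=> //.
exact: (repr_at_map (fil_proj F (be_le hp)) e' (be_deg hp hq) zx).
Qed.

Lemma gr_class_ga n n' p q p' q' (hp : p' = p + 1) (hq : q' = q + 0)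
    (e : n = p + q) (e' : n' = p' + q') (en : n' = n + 1) y u :
  gr_class e y u -> fil_class e' (cdif M en y) (fil_ga F hp hq u).
Proof.
move=> [yF [<- yu]].
subst n n'; pose SE := fil_short_exact F hp erefl (ga_le hp) (lexx p).
have yF1 : quot_pi _ yF = fil_proj F (lexx p) _ yF.
  by congr quot_pi; exact: submod_inj.
rewrite yF1 in yu; have [a [v [av ea]]] := connecting_ex SE en yu.
exists a; split; first by have := congr1 (@subval _ _ _) ea.
rewrite /fil_ga (eq_irrelevance (ga_deg hp hq) en).
by rewrite (connectingE SE yu av ea).
Qed.

(** The D-term of the r-th derived couple is a submodule of that of the couple of
the filtration, namely the image of al iterated r times. *)
Fixpoint der_val r p q : ec_D (couple r) p q -> fil_D F p q :=
  match r return ec_D (couple r) p q -> fil_D F p q with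
  | 0 => id
  | r'.+1 => fun x => der_val (subval (x : der_D (couple r') p q))
  end.

Lemma der_val_inj r p q : injective (@der_val r p q).
Proof. by elim: r => [|r IH] x y //= /IH/submod_inj. Qed.

Lemma der_val_al r (p q p' q' : int) (hp : p' = p + -1) (hq : q' = q + 1) x :
  der_val (ec_al (couple r) hp hq x) = fil_al F hp hq (der_val x).
Proof. by elim: r x => [|r IH] x //=; rewrite IH. Qed.

(** The class of y on page 0 is a cycle, whose class on page 1 is again a cycle, and
so on until u is reached on page r. *)
Fixpoint page_repr r n p q (e : n = p + q) (y : M n) :
    ss_page (fil_ss F) r p q -> Prop :=
  match r return ss_page (fil_ss F) r p q -> Prop with
  | 0 => gr_class e y
  | r'.+1 => fun u => exists u', page_repr e y u' /\
      birepr (d := ec_dif (couple r')) u' u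
  end.

Lemma page_repr_fun r n p q (e : n = p + q) y (u v : ss_page (fil_ss F) r p q) :
  page_repr e y u -> page_repr e y v -> u = v.
Proof.
elim: r u v => [|r IH] u v /=.
  move=> [yF [ey yu]] [yF' [ey' yv]]; apply: repr_at_fun yu _.
  by rewrite (_ : yF = yF') //; apply: submod_inj; rewrite ey.
move=> [u' [yu' u'u]] [v' [yv' v'v]].
by rewrite (IH _ _ yu' yv') in u'u; exact: repr_fun u'u v'v.
Qed.

(** Page 0, the cohomology of F^p / F^{p+1}, already forgets F^{p+1}. *)
Lemma page_repr_lead r n p q (e : n = p + q) y y' (u : ss_page (fil_ss F) r p q) :
  y \in F p n -> y' \in F p n ->
  y - y' \in F (p + 1) n -> page_repr e y u -> page_repr e y' u.
Proof.
move=> yF y'F yy'; elim: r u => [|r IH] u /=; last first.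
  by move=> [u' [/IH yu' u'u]]; exists u'.
move=> [z [ez zu]]; exists (Submod y'F); split=> //.
rewrite (_ : quot_pi _ _ = quot_pi _ z) //; apply/esym/quot_piE/mk_submodE.
by rewrite linearB /= ez.
Qed.

Lemma der_val_ga r n n' (p q p' q' : int) (hp : p' = p + 1) (hq : q' = q + 0)
    (e : n = p + q) (e' : n' = p' + q') (en : n' = n + 1) y u :
  page_repr e y u ->
  fil_class e' (cdif M en y) (der_val (ec_ga (couple r) hp hq u)).
Proof.
elim: r u => [|r IH] u; first exact: gr_class_ga.
move=> [u' [/IH yu' u'u]].
by rewrite [der_val _]/= (der_gaE hp hq u'u).
Qed.

(** A cocycle of F^{p+r} has a class in F^{p+r}, whose image under al iterated r
times is its class in F^p. *)
Lemma der_val_ex r n n' (p q : int) (e : n = p + q) (en : n' = n + 1) z :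
  z \in F (p + r%:Z) n -> cdif M en z = 0 ->
  exists x : ec_D (couple r) p q, fil_class e z (der_val x).
Proof.
move=> + dz; elim: r p q e => [|r IH] p q e zF.
  by rewrite addr0 in zF; exact: fil_class_ex dz.
have e1 : n = p + 1 + (q - 1) by lia.
have hp : p = p + 1 + -1 by lia.
have hq : q = q - 1 + 1 by lia.
have [|x zx] := IH _ _ e1; first by rewrite (_ : _ + _ = p + r.+1%:Z) //; lia.
have xP : ec_al (couple r) hp hq x \in biimage (ec_al (couple r)) p q.
  by apply/(biimageP _ hp hq); exists x.
exists (Submod xP); rewrite /= der_val_al; exact: fil_class_al zx.
Qed.

(** The map be of the r-th derived couple divides by al iterated r times before
projecting to the graded complex; dividing the class in F^p of a cocycle z of
F^{p+r} means taking its class in F^{p+r}. *)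
Lemma page_repr_be r n n' (p q p' q' : int) (hp : p' = p + r%:Z)
    (hq : q' = q + - r%:Z) (e : n = p + q) (e' : n = p' + q') (en : n' = n + 1)
    z x : z \in F p' n -> cdif M en z = 0 ->
  fil_class e z (der_val x) -> page_repr e' z (ec_be (couple r) hp hq x).
Proof.
move=> + dz; elim: r p q p' q' hp hq e e' x => [|r IH] p q p' q' hp hq e e' x zF zx.
  exact: fil_class_be zx.
have e1 : n = p + 1 + (q - 1) by lia.
have hp1 : p = p + 1 + -1 by lia.
have hq1 : q = q - 1 + 1 by lia.
have hp2 : p' = p + 1 + r%:Z by lia.
have hq2 : q' = q - 1 + - r%:Z by lia.
have [|x1 zx1] := @der_val_ex r _ _ _ _ e1 en z _ dz; first by rewrite -hp2.
exists (ec_be (couple r) hp2 hq2 x1); split; first exact: IH zx1.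
apply: der_beE; apply: der_val_inj.
rewrite der_val_al; apply: fil_class_fun zx; exact: fil_class_al zx1.
Qed.

(** The classical description of the differentials: d_{r+1} [y] = [d y] when d y
lies in F^{p+r+1}. *)
Lemma page_repr_dif r n n' (p q p' q' : int) (hp : p' = p + r.+1%:Z)
    (hq : q' = q + (1 - r.+1%:Z)) (e : n = p + q) (e' : n' = p' + q')
    (en : n' = n + 1) y u : cdif M en y \in F p' n' -> page_repr e y u ->
  page_repr e' (cdif M en y) (ss_dif (fil_ss F) hp hq u).
Proof.
move=> dyF yu; have e1 : n' = p + 1 + (q + 0) by lia.
apply: (@page_repr_be r n' _ (p + 1) (q + 0) p' q' _ _ e1 e' erefl) => //.
  exact: cdifK.
exact: der_val_ga yu.
Qed.

End Representatives.

Lemma inj_surj_bij (A B : Type) (f : A -> B) :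
  injective f -> (forall y, exists x, f x = y) -> bijective f.
Proof.
move=> finj fsurj; pose g y := projT1 (cid (fsurj y)).
have fK : cancel g f by move=> y; rewrite /g; case: cid.
by exists g => // x; apply: finj.
Qed.

Lemma homology_map_bij (k : fieldType) (U V W U' V' W' : lmodType k)
    (f : {linear U -> V}) (g : {linear V -> W})
    (f' : {linear U' -> V'}) (g' : {linear V' -> W'})
    (hU : {linear U -> U'}) (hV : {linear V -> V'}) (hW : {linear W -> W'})
    (hf : forall x, hV (f x) = f' (hU x)) (hg : forall x, hW (g x) = g' (hV x)) :
  bijective hU -> bijective hV -> bijective hW ->
  bijective (homology_map hf hg).
Proof.
move=> [iU _ iUK] /[dup]/bij_inj injV [iV _ iVK] /bij_inj injW.
apply: inj_surj_bij => [u v|v].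
  have [x xu] := repr_surj u; have [y yv] := repr_surj v.
  move/(repr_eq (homology_mapE hf hg xu) (homology_mapE hf hg yv)) => [t].
  rewrite -[t]iUK -hf -linearB => /injV ft.
  by apply/(repr_eq xu yv); exists (iU t).
have [y yv] := repr_surj v.
have [|u xu] := @repr_ex _ _ _ _ f g (iV y).
  by apply: injW; rewrite hg iVK (repr_cycle yv) linear0.
exists u; apply: repr_fun yv.
by rewrite -[y]iVK; exact: homology_mapE.
Qed.

(** * The isomorphism of spectral sequences *)

Section Realization.
Variables (k : fieldType) (E : spectral_sequence k).

Definition real_complex : complex k := laurent_complex (@total_difK k E).
Definition real_fil : filtration real_complex := laurent_fil (@total_difK k E).
Local Notation M := real_complex.
Local Notation F := real_fil.
Local Notation lead p q x :=
  (single (@total_difK k E) (erefl (p + q)) x : real_complex (p + q)).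

Lemma gr_dif0 p n n' (en : n' = n + 1) t : cdif (gr_complex F p) en t = 0.
Proof.
have [y <-] := quot_pi_surj t.
rewrite [LHS]quot_mapE -[RHS](linear0 (quot_pi (gr_sub F p n'))).
apply/quot_piE; rewrite subr0; apply/mk_submodE.
exact: laurent_fil_dif1 (subvalP y).
Qed.

(** The graph of the map from the first page to E_1 that takes the leading
component of a family. *)
Definition lead_rel p q (u : ss_page (fil_ss F) 0 p q) (x : ss_page E 0 p q) :=
  page_repr (erefl (p + q)) (lead p q x) u.

Lemma lead_rel_tot p q u : exists x, @lead_rel p q u x.
Proof.
have [t tu] := repr_at_surj (erefl (p + q)) u.
have [y ty] := quot_pi_surj t; subst t.
exists (coef erefl (subval (subval y))).
apply: (@page_repr_lead _ _ _ 0 _ _ _ _ (subval y)); first exact: subvalP.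
- exact: single_fil.
- exact: single_lead (subvalP y).
- by exists y.
Qed.

Lemma lead_rel_fun p q u x x' : @lead_rel p q u x -> lead_rel u x' -> x = x'.
Proof.
move=> [y [ey yu]] [y' [ey' yu']].
have [t] := (repr_at_eq (index_prev 1 (p + q)) yu yu').1 erefl.
rewrite gr_dif0 -linearB -(linear0 (quot_pi (gr_sub F p (p + q)))) => /esym/quot_piE.
rewrite subr0 => /mk_submodE; rewrite linearB /= ey ey' -linearB /= => /laurent_filP.
move/(_ p q erefl); rewrite /= coef_single => /(_ _)/eqP.
by rewrite subr_eq0 => /(_ _)/eqP; apply; lia.
Qed.

Lemma lead_rel_lin p q a u u' x x' :
  @lead_rel p q u x -> @lead_rel p q u' x' -> lead_rel (a *: u + u') (a *: x + x').
Proof.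
move=> [y [ey yu]] [y' [ey' yu']]; exists (a *: y + y').
split; first by rewrite !linearP /= ey ey'.
by rewrite linearP; exact: repr_at_lin.
Qed.

Lemma lead_rel_ex p q x : exists u, @lead_rel p q u x.
Proof.
pose y : fil_complex F p (p + q) := Submod (single_fil _ (erefl (p + q)) x).
have [u yu] := @repr_at_ex _ (gr_complex F p) _ _ _ erefl erefl (quot_pi _ y)
  (gr_dif0 _ _).
by exists u, y.
Qed.

Definition lead_map p q : {linear ss_page (fil_ss F) 0 p q -> ss_page E 0 p q} :=
  graph_map (@lead_rel_tot p q) (@lead_rel_fun p q) (@lead_rel_lin p q).

Lemma lead_map_bij p q : bijective (lead_map p q).
Proof.
apply: inj_surj_bij => [u v uv|x].
  have ux := graph_mapP (@lead_rel_tot p q) (@lead_rel_fun p q) (@lead_rel_lin p q) u.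
  have vx := graph_mapP (@lead_rel_tot p q) (@lead_rel_fun p q) (@lead_rel_lin p q) v.
  by rewrite -/(lead_map p q) uv in ux; exact: page_repr_fun ux vx.
by have [u ux] := lead_rel_ex x; exists u; exact: graph_mapE.
Qed.

(** The invariant of the recursion on pages: f sends the class of the lift of x to
x. For f bijective this determines f. *)
Definition matches_lift r
    (f : forall p q, {linear ss_page (fil_ss F) r p q -> ss_page E r p q}) :=
  forall p q x, exists u,
    page_repr (erefl (p + q)) (lead p q (lift1 E r p q x)) u /\ f p q u = x.

Lemma lead_map_lift : matches_lift lead_map.
Proof.
by move=> p q x; have [u ux] := lead_rel_ex x; exists u; split=> //; exact: graph_mapE.
Qed.

(** Let u be the class of the lift of x. Then d u is represented by the
differential of that lift, whose leading component is the lift of d x; so d u is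
the class that f sends to d x. *)
Lemma matches_lift_dif r
    (f : forall p q, {linear ss_page (fil_ss F) r p q -> ss_page E r p q}) :
  (forall p q, bijective (f p q)) -> matches_lift f ->
  forall (p q p' q' : int) (hp : p' = p + r.+1%:Z) (hq : q' = q + (1 - r.+1%:Z)) u,
  f p' q' (ss_dif (fil_ss F) hp hq u) = ss_dif E hp hq (f p q u).
Proof.
move=> fbij fE p q p' q' hp hq v.
have [u [xu fu]] := fE p q (f p q v); have uv := bij_inj (fbij p q) fu; subst u.
move: (f p q v) xu => x xu {fu}.
have [w [wx <-]] := fE p' q' (ss_dif E hp hq x); congr (f p' q' _).
have en : p' + q' = p + q + 1 by lia.
have [|dF dlead] := @dif_single _ _ _ (@total_difK k E) _ _ en r p q p' q'
    erefl erefl hp hq (lift1 E r p q x).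
  by move=> s p1 q1 hp1 hq1; exact: total_dif_lift0.
rewrite total_dif_lift in dlead.
apply: page_repr_fun wx.
exact: page_repr_lead dF (single_fil _ _ _) dlead (page_repr_dif _ _ _ dF xu).
Qed.

(** Bundled with its properties, because the map on the next page exists only
once the compatibility with the differential is proved. *)
Definition page_iso r :=
  {f : forall p q, {linear ss_page (fil_ss F) r p q -> ss_page E r p q} |
    (forall p q, bijective (f p q)) /\ matches_lift f}.

Definition page_iso_dif r (f : page_iso r) :=
  matches_lift_dif (projT2 f).1 (projT2 f).2.

Definition next_page r (f : page_iso r) p q :
    {linear ss_page (fil_ss F) r.+1 p q -> ss_page E r.+1 p q} :=
  ss_iso E r p q \o bihomology_map (page_iso_dif f) p q.

Lemma next_pageP r (f : page_iso r) :
  (forall p q, bijective (next_page f p q)) /\ matches_lift (next_page f).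
Proof.
split=> p q.
  apply: bij_comp; first exact: ss_iso_bij.
  by apply: homology_map_bij; exact: (projT2 f).1.
(* The lift of x to the first page passes through page_lift x, a cycle of
   page r which represents x. *)
move=> x; have [inv _ invK] := ss_iso_bij E r p q.
have [u' [xu' fu']] := (projT2 f).2 p q (page_lift E r p q x).
pose fdif := page_iso_dif f.
have [|u u'u] := @birepr_ex _ _ _ _ (ss_dif (fil_ss F) (r := r)) p q _ _ erefl erefl u'.
  apply: (bij_inj ((projT2 f).1 _ _)).
  by rewrite fdif fu' dif_page_lift linear0.
exists u; split; first by exists u'.
rewrite /= -[RHS]invK; congr (ss_iso E r p q _).
have := homology_mapE (fdif _ _ p q (index_prev _ p) (index_prev _ q))
  (fdif p q _ _ erefl erefl) u'u.
rewrite fu' -{1}[x]invK => xu; exact: repr_fun xu (page_liftP _).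
Qed.

Fixpoint page_isos r : page_iso r :=
  match r with
  | 0 => exist _ lead_map (conj lead_map_bij lead_map_lift)
  | r'.+1 => exist _ _ (next_pageP (page_isos r'))
  end.

Definition real_iso : ss_morphism (fil_ss F) E :=
  @SSMorphism k (fil_ss F) E (fun r => projT1 (page_isos r))
    (fun r => page_iso_dif (page_isos r)) (fun r p q u => erefl).

End Realization.

Theorem mainTheorem5 (k : fieldType) (E : spectral_sequence k) :
  exists (M : complex k) (F : filtration M), ss_isomorphic (fil_ss F) E.
Proof.
exists (real_complex E), (real_fil E), (real_iso E) => r p q.
exact: (projT2 (page_isos E r)).1.
Qed.
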